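(* Let $X\subset\mathbb{P}^4$ be a smooth quintic threefold over $\mathbb{C}$. Suppose $\mathrm{Aut}(X)$ contains an element of order $41$. Then $\mathrm{Aut}(X)$ is isomorphic to a subgroup of the group $G_{15}\subset \mathrm{PGL}(5,\mathbb{C})$ generated by the classes of the three matrices $$\begin{pmatrix}0&1&0&0&0\\0&0&1&0&0\\0&0&0&1&0\\0&0&0&0&1\\1&0&0&0&0\end{pmatrix},\quad \mathrm{diag}(1,\xi_5,\xi_5^2,\xi_5^3,\xi_5^4),\quad \mathrm{diag}(\xi_{41},\xi_{41}^{-4},\xi_{41}^{16},\xi_{41}^{18},\xi_{41}^{10}),$$ and $|\mathrm{Aut}(X)|$ is divisible by $5$.
   Context: $\xi_k=e^{2\pi i/k}$. A smooth quintic threefold is a smooth hypersurface of degree $5$ in $\mathbb{P}^4$; its automorphism group is finite and is identified with $\{\varphi\in\mathrm{PGL}(5,\mathbb{C}) : \varphi(X)=X\}$. *)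

(* Defs.v *)
From HB Require Import structures.
From mathcomp Require Import all_boot all_order all_algebra.
From mathcomp Require Import complex.
From mathcomp Require Import all_classical all_reals trigo.
(* The notations of mpoly are incompatible with those of mathcomp-analysis. *)
From mathcomp Require Import -(notations) mpoly.

Set Implicit Arguments.
Unset Strict Implicit.
Unset Printing Implicit Defensive.

Import Order.TTheory GRing.Theory Num.Theory.
Local Open Scope classical_set_scope.
Local Open Scope ring_scope.
Local Open Scope quotient_scope.

Section Groups.
Variable G : groupType.
Local Open Scope group_scope.

Definition is_subgroup (H : set G) : Prop := group_closed (mem H).

Definition generated_by (S : set G) : set G :=
  \bigcap_(H in [set H : set G | is_subgroup H /\ S `<=` H]) H.

Definition has_order (g : G) (n : nat) : Prop :=
  [/\ (0 < n)%N, g ^+ n = 1 & forall m, (0 < m < n)%N -> g ^+ m <> 1].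

(* Only meaningful when [H] and [K] are subgroups. *)
Definition isomorphic_subgroups (H K : set G) : Prop :=
  exists2 f : G -> G, set_bij H K f &
    forall x y, H x -> H y -> f (x * y) = f x * f y.

End Groups.

Section ProjectiveLinearGroup.
Variables (F : fieldType) (n : nat).

Record GL := MkGL { GLmx :> 'M[F]_n; GL_unit : GLmx \in unitmx }.

HB.instance Definition _ := [isSub for GLmx].
HB.instance Definition _ := [Choice of GL by <:].

Definition GL_one : GL := MkGL (unitmx1 F n).

Fact GL_mul_unit (A B : GL) : GLmx A *m GLmx B \in unitmx.
Proof. by rewrite unitmx_mul !GL_unit. Qed.
Definition GL_mul (A B : GL) : GL := MkGL (GL_mul_unit A B).

Fact GL_inv_unit (A : GL) : invmx (GLmx A) \in unitmx.
Proof. by rewrite unitmx_inv GL_unit. Qed.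
Definition GL_inv (A : GL) : GL := MkGL (GL_inv_unit A).

Definition GL_prop (A B : GL) : bool :=
  `[< exists2 c : F, c != 0 & GLmx A = c *: GLmx B >].

Fact GL_prop_refl : reflexive GL_prop.
Proof. by move=> A; apply/asboolP; exists 1; rewrite ?oner_eq0 ?scale1r. Qed.

Fact GL_prop_sym : ssrbool.symmetric GL_prop.
Proof.
suff s A B : GL_prop A B -> GL_prop B A by move=> A B; apply/idP/idP; apply: s.
move=> /asboolP[c c0 AB]; apply/asboolP; exists c^-1; first by rewrite invr_eq0.
by rewrite AB scalerA mulVf ?scale1r.
Qed.

Fact GL_prop_trans : transitive GL_prop.
Proof.
move=> B A D /asboolP[c c0 AB] /asboolP[d d0 BD]; apply/asboolP.
by exists (c * d); rewrite ?mulf_neq0// AB BD scalerA.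
Qed.

Canonical GL_prop_equiv :=
  EquivRel GL_prop GL_prop_refl GL_prop_sym GL_prop_trans.

Definition PGL := {eq_quot GL_prop}.

HB.instance Definition _ := EqQuotient.on PGL.
HB.instance Definition _ := Choice.on PGL.

Definition PGL_one : PGL := \pi_PGL GL_one.
Definition PGL_mul (g h : PGL) : PGL := \pi_PGL (GL_mul (repr g) (repr h)).
Definition PGL_inv (g : PGL) : PGL := \pi_PGL (GL_inv (repr g)).

Lemma PGL_eqP (A B : GL) :
  reflect (exists2 c : F, c != 0 & GLmx A = c *: GLmx B) (\pi_PGL A == \pi_PGL B).
Proof. by rewrite eqmodE; apply: asboolP. Qed.

Lemma PGL_reprP (A : GL) :
  exists2 c : F, c != 0 & GLmx (repr (\pi_PGL A)) = c *: GLmx A.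
Proof. by apply/PGL_eqP; rewrite reprK. Qed.

Lemma PGL_mulE (A B : GL) : PGL_mul (\pi_PGL A) (\pi_PGL B) = \pi_PGL (GL_mul A B).
Proof.
have [c c0 Ac] := PGL_reprP A; have [d d0 Bd] := PGL_reprP B.
apply/eqP/PGL_eqP; exists (c * d); rewrite ?mulf_neq0//= Ac Bd.
by rewrite -scalemxAl -scalemxAr scalerA.
Qed.

Lemma PGL_invE (A : GL) : PGL_inv (\pi_PGL A) = \pi_PGL (GL_inv A).
Proof.
have [c c0 Ac] := PGL_reprP A.
apply/eqP/PGL_eqP; exists c^-1; rewrite ?invr_eq0//= Ac.
by rewrite invmxZ// ?unitfE// -?Ac ?GL_unit.
Qed.

Fact PGL_mulA : associative PGL_mul.
Proof.
elim/quotW=> A; elim/quotW=> B; elim/quotW=> D.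
rewrite (PGL_mulE B D) (PGL_mulE A B) !PGL_mulE.
by apply: congr1; apply: val_inj; rewrite /= mulmxA.
Qed.
Fact PGL_mul1g : left_id PGL_one PGL_mul.
Proof.
elim/quotW=> A; rewrite PGL_mulE.
by apply: congr1; apply: val_inj; rewrite /= mul1mx.
Qed.
Fact PGL_mulg1 : right_id PGL_one PGL_mul.
Proof.
elim/quotW=> A; rewrite PGL_mulE.
by apply: congr1; apply: val_inj; rewrite /= mulmx1.
Qed.
Fact PGL_mulVg : left_inverse PGL_one PGL_inv PGL_mul.
Proof.
elim/quotW=> A; rewrite (PGL_invE A) PGL_mulE.
by apply: congr1; apply: val_inj; rewrite /= mulVmx ?GL_unit.
Qed.
Fact PGL_mulgV : right_inverse PGL_one PGL_inv PGL_mul.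
Proof.
elim/quotW=> A; rewrite (PGL_invE A) PGL_mulE.
by apply: congr1; apply: val_inj; rewrite /= mulmxV ?GL_unit.
Qed.

HB.instance Definition _ := isGroup.Build PGL
  PGL_mulA PGL_mul1g PGL_mulg1 PGL_mulVg PGL_mulgV.

End ProjectiveLinearGroup.

(* [projspace F n] is P^n: nonzero column vectors with n+1 coordinates, modulo
   scalars. *)
Section ProjectiveSpace.
Variables (F : fieldType) (n : nat).

Record nzvec := MkNzvec { nzvec_cV :> 'cV[F]_n.+1; nzvec_neq0 : nzvec_cV != 0 }.

HB.instance Definition _ := [isSub for nzvec_cV].
HB.instance Definition _ := [Choice of nzvec by <:].

Definition nzvec_prop (u v : nzvec) : bool :=
  `[< exists2 c : F, c != 0 & nzvec_cV u = c *: nzvec_cV v >].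

Fact nzvec_prop_refl : reflexive nzvec_prop.
Proof. by move=> u; apply/asboolP; exists 1; rewrite ?oner_eq0 ?scale1r. Qed.

Fact nzvec_prop_sym : ssrbool.symmetric nzvec_prop.
Proof.
suff s u v : nzvec_prop u v -> nzvec_prop v u
  by move=> u v; apply/idP/idP; apply: s.
move=> /asboolP[c c0 uv]; apply/asboolP; exists c^-1; first by rewrite invr_eq0.
by rewrite uv scalerA mulVf ?scale1r.
Qed.

Fact nzvec_prop_trans : transitive nzvec_prop.
Proof.
move=> v u w /asboolP[c c0 uv] /asboolP[d d0 vw]; apply/asboolP.
by exists (c * d); rewrite ?mulf_neq0// uv vw scalerA.
Qed.

Canonical nzvec_prop_equiv :=
  EquivRel nzvec_prop nzvec_prop_refl nzvec_prop_sym nzvec_prop_trans.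

Definition projspace := {eq_quot nzvec_prop}.

HB.instance Definition _ := EqQuotient.on projspace.
HB.instance Definition _ := Choice.on projspace.

Lemma projspace_eqP (u v : nzvec) :
  reflect (exists2 c : F, c != 0 & nzvec_cV u = c *: nzvec_cV v)
          (\pi_projspace u == \pi_projspace v).
Proof. by rewrite eqmodE; apply: asboolP. Qed.

Lemma projspace_reprP (v : nzvec) :
  exists2 c : F, c != 0 & nzvec_cV (repr (\pi_projspace v)) = c *: nzvec_cV v.
Proof. by apply/projspace_eqP; rewrite reprK. Qed.

Fact GL_act_neq0 (A : GL F n.+1) (v : nzvec) : GLmx A *m nzvec_cV v != 0.
Proof.
apply: contra (nzvec_neq0 v) => /eqP Av0.
by rewrite -[nzvec_cV v](mulKmx (GL_unit A)) Av0 mulmx0.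
Qed.
Definition GL_act (A : GL F n.+1) (v : nzvec) : nzvec := MkNzvec (GL_act_neq0 A v).

Definition PGL_act (g : PGL F n.+1) (x : projspace) : projspace :=
  \pi_projspace (GL_act (repr g) (repr x)).

Lemma PGL_actE (A : GL F n.+1) (v : nzvec) :
  PGL_act (\pi_(PGL F n.+1) A) (\pi_projspace v) = \pi_projspace (GL_act A v).
Proof.
have [c c0 Ac] := PGL_reprP A; have [d d0 vd] := projspace_reprP v.
apply/eqP/projspace_eqP; exists (c * d); rewrite ?mulf_neq0//= Ac vd.
by rewrite -scalemxAl -scalemxAr scalerA.
Qed.

Lemma PGL_act1 (x : projspace) : PGL_act 1%g x = x.
Proof.
elim/quotW: x => v; rewrite PGL_actE.
by apply: congr1; apply: val_inj; rewrite /= mul1mx.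
Qed.

Lemma PGL_actM (g h : PGL F n.+1) (x : projspace) :
  PGL_act (g * h)%g x = PGL_act g (PGL_act h x).
Proof.
elim/quotW: g => A; elim/quotW: h => B; elim/quotW: x => v.
rewrite [(_ * _)%g](PGL_mulE A B) (PGL_actE B v) !PGL_actE.
by apply: congr1; apply: val_inj; rewrite /= mulmxA.
Qed.

Definition coords (x : projspace) : 'I_n.+1 -> F := fun i => repr x i 0.

(* For [p] homogeneous, neither set below depends on the chosen coordinates
   (see [zero_locusE]). *)
Definition zero_locus (p : mpoly n.+1 F) : set projspace :=
  [set x | meval (coords x) p = 0].

Definition singular_locus (p : mpoly n.+1 F) : set projspace :=
  zero_locus p `&` [set x | forall i, meval (coords x) (mderiv i p) = 0].

Lemma meval_homogZ (p : mpoly n.+1 F) (d : nat) (c : F) (v : 'I_n.+1 -> F) :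
  p \is ishomog1 d mdeg -> meval (fun i => c * v i) p = c ^+ d * meval v p.
Proof.
move=> /dhomogP hp; rewrite !mevalE mulr_sumr; apply: eq_big_seq => m /hp <-.
rewrite mulrCA; congr (_ * _); rewrite /= mdegE -prodrXr -big_split/=.
by apply: eq_bigr => i _; rewrite exprMn.
Qed.

Lemma zero_locusE (p : mpoly n.+1 F) (d : nat) (v : nzvec) :
  p \is ishomog1 d mdeg ->
  zero_locus p (\pi_projspace v) <-> meval (fun i => nzvec_cV v i 0) p = 0.
Proof.
move=> hp; have [c c0 vc] := projspace_reprP v.
have -> : zero_locus p (\pi_projspace v) = (meval (fun i => c * nzvec_cV v i 0) p = 0).
  rewrite /zero_locus/=; congr (_ = _); apply: meval_eq => i.
  by rewrite /coords vc mxE.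
rewrite (meval_homogZ _ _ hp); split=> [/eqP|->]; last by rewrite mulr0.
by rewrite mulf_eq0 expf_eq0 (negPf c0) andbF/= => /eqP.
Qed.

(* Jacobian criterion; the base field is meant to be algebraically closed. *)
Definition smooth_hypersurface (d : nat) (X : set projspace) : Prop :=
  exists p : mpoly n.+1 F,
    [/\ p != 0, p \is ishomog1 d mdeg, X = zero_locus p
      & singular_locus p = set0].

(* For a smooth quintic threefold every automorphism is linear, so this is the
   whole automorphism group. *)
Definition projAut (X : set projspace) : set (PGL F n.+1) :=
  [set g | PGL_act g @` X = X].

Lemma projAut_subgroup (X : set projspace) : is_subgroup (projAut X).
Proof.
split=> [|g h]; rewrite !inE /projAut/=.
  by rewrite (eq_imagel (f' := id)) ?image_id// => x _; rewrite PGL_act1.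
move=> gX hX; rewrite -[in LHS]hX image_comp.
rewrite (eq_imagel (f' := PGL_act g)) ?gX// => x _ /=.
by rewrite -PGL_actM mulgVK.
Qed.

End ProjectiveSpace.

Section G15.
Variable R : realType.
Local Notation C := R[i].

(* e^(2 pi i / k) *)
Definition xi (k : nat) : C :=
  let t := 2 * pi / k%:R in Complex (cos t) (sin t).

Lemma xi_neq0 k : xi k != 0.
Proof.
apply/eqP => -[c0 s0]; have := @cos2Dsin2 R (2 * pi / k%:R).
by rewrite c0 s0 !expr0n/= addr0 => /esym/eqP; rewrite oner_eq0.
Qed.

Lemma diag_unit n (d : 'I_n -> C) : (forall j, d j != 0) ->
  diag_mx (\row_j d j) \in unitmx.
Proof.
move=> d0; rewrite unitmxE det_diag unitfE; apply/prodf_neq0 => j _.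
by rewrite mxE.
Qed.

Definition cycle_mx : 'M[C]_5 := \matrix_(i, j) (j == i.+1 %% 5 :> nat)%N%:R.

Lemma cycle_unit : cycle_mx \in unitmx.
Proof.
suff: cycle_mx *m cycle_mx^T = 1%:M by case/mulmx1_unit.
apply/matrixP => i j; rewrite !mxE.
pose k : 'I_5 := Ordinal (ltn_pmod i.+1 (isT : (0 < 5)%N)).
rewrite (bigD1 k)//= !mxE eqxx mul1r big1 ?addr0 => [|l lk].
  congr (_%:R); rewrite -val_eqE/= {k}.
  case: i j => i + [j +] /=.
  by do 5?[case: i => [|i] //]; do 5?[case: j => [|j] //].
rewrite !mxE (_ : (l == i.+1 %% 5 :> nat)%N = false) ?mul0r//.
exact/negbTE.
Qed.

Definition diag5 (j : 'I_5) : C := xi 5 ^+ j.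
Definition diag41 (j : 'I_5) : C := xi 41 ^ ([:: 1; -4; 16; 18; 10 : int]`_j).

Lemma diag5_neq0 j : diag5 j != 0.
Proof. by rewrite expf_neq0 ?xi_neq0. Qed.
Lemma diag41_neq0 j : diag41 j != 0.
Proof. by rewrite expfz_neq0 ?xi_neq0. Qed.

Definition G15 : set (PGL C 5) :=
  generated_by [set \pi_(PGL C 5) (MkGL cycle_unit);
                    \pi_(PGL C 5) (MkGL (diag_unit diag5_neq0));
                    \pi_(PGL C 5) (MkGL (diag_unit diag41_neq0))].

End G15.

Arguments G15 : clear implicits.

(* Main.v *)
(* Two degree-5 forms F, G with F smooth and G = 0 on F = 0 are proportional:
   through any point there is a plane in which almost every line of a pencil meets
   F = 0 in 5 distinct points, and on such a line G is a multiple of F.  Hence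
   Aut(X) consists of the classes of the A with F(Ax) = c F(x).

   An element of order 41 lifts to B with B^41 = 1 and F(Bx) = F(x).  Smoothness at an
   eigenvector of eigenvalue b gives an eigenvalue b' with b^4 b' = 1; since -4 has
   order 5 modulo 41, the eigenvalues are z^((-4)^i), i in Z/5, and the only
   invariant quintic monomials are the x_i^4 x_{i+1} and x_0 x_1 x_2 x_3 x_4.  After
   rescaling, F = sum_i x_i^4 x_{i+1} + lam x_0 x_1 x_2 x_3 x_4.

   For this F the second derivative of F along v is a cubic of the form l^2 m only
   if v is a multiple of a basis vector, whatever lam is.  This condition is
   invariant, so automorphisms permute the coordinate axes, and comparing monomials
   leaves a power of the cyclic shift times diag(a) with a_i^4 a_{i+1} constant,
   i.e., an element of G15.  The cyclic shift itself always preserves F, and it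
   translates the finite group Aut(X) freely, whence 5 divides the order. *)
Require Import Defs.
From HB Require Import structures.
From mathcomp Require Import all_boot all_order all_algebra.
From mathcomp Require Import complex.
From mathcomp Require Import all_classical all_reals trigo.
From mathcomp Require Import -(notations) mpoly.
From mathcomp Require Import finmap fingroup perm action cyclic pgroup sylow.
From mathcomp Require Import polyXY separable cyclotomic ring.

Set Implicit Arguments.
Unset Strict Implicit.
Unset Printing Implicit Defensive.

Import Order.TTheory GRing.Theory Num.Theory.
Local Open Scope classical_set_scope.
Local Open Scope ring_scope.

(** * Proportionality of forms with the same zeros *)

Lemma poly_horner_inj (k : closedFieldType) (p q : {poly k}) :
  (forall x, p.[x] = q.[x]) -> p = q.
Proof.
move=> pq; apply/eqP; rewrite -subr_eq0; apply: contraTT isT.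
move=> /closed_nonrootP[x]; rewrite rootE hornerD hornerN pq subrr eqxx//.
Qed.

(** * Two-variable polynomials: separability of the general fibre *)

Section GenericSeparability.
Variable k : numClosedFieldType.
Implicit Types H U V : {poly {poly k}}.

(* The hypotheses are the terms of order 0 and 1 in s of a relation U h = V h',
   where h = h0 + s h1 + O(s^2) and h' is the derivative in the other variable. *)
Lemma dvdp_of_relation (h0 h1 u0 u1 v0 v1 : {poly k}) : h0 != 0 ->
  (forall x, root h0 x -> ~~ root h1 x) ->
  u0 * h0 = v0 * h0^`() ->
  u0 * h1 + u1 * h0 = v0 * h1^`() + v1 * h0^`() ->
  h0 %| v0.
Proof.
move=> h0N0 rh E0 E1; set g := gcdp h0 h0^`().
have gN0 : g != 0 by rewrite gcdp_eq0 (negPf h0N0).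
have [a h0E] : exists a, h0 = a * g.
  by exists (h0 %/ g); rewrite divpK// dvdp_gcdl.
have [b h0'E] : exists b, h0^`() = b * g.
  by exists (h0^`() %/ g); rewrite divpK// dvdp_gcdr.
have cab : coprimep a b.
  have := @coprimep_div_gcd k h0 h0^`().
  rewrite h0N0 /= => /(_ isT); rewrite -/g.
  by rewrite {1}h0E h0'E !mulpK.
(* In characteristic 0 differentiation lowers the multiplicity of a root by exactly one, so dividing
   [h0] by the gcd keeps every root. *)
have ra x : root h0 x -> root a x.
  move=> rx; have [m [q nq h0q]] := multiplicity_XsubC h0 x.
  have m_gt0 : (0 < m)%N.
    case: m h0q rx => // ->; rewrite expr0 mulr1 => rq.
    by move: nq; rewrite h0N0 rq.
  have D : h0^`() = (m%:R *: q + ('X - x%:P) * q^`()) * ('X - x%:P) ^+ m.-1.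
    rewrite h0q derivM deriv_exp derivXsubC mul1r.
    rewrite -[in X in _ * X + _](prednK m_gt0) exprS scaler_nat -mulr_natl.
    by ring.
  have : a * h0^`() = b * h0 by rewrite h0'E [in RHS]h0E; ring.
  rewrite D h0q -[in RHS](prednK m_gt0) exprS => H.
  have nz : ('X - x%:P) ^+ m.-1 != 0 by rewrite expf_neq0// polyXsubC_eq0.
  have {}H : a * (m%:R *: q + ('X - x%:P) * q^`()) * ('X - x%:P) ^+ m.-1 =
      b * q * ('X - x%:P) * ('X - x%:P) ^+ m.-1.
    by rewrite -[LHS]mulrA H; ring.
  have /eqP := congr1 (horner^~ x) (mulIf nz H).
  rewrite !hornerE subrr !mul0r addr0 mulr0.
  rewrite mulf_eq0 mulf_eq0 pnatr_eq0 (gtn_eqF m_gt0)/=.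
  by move: nq; rewrite h0N0 /= => /negPf; rewrite !rootE => ->; rewrite orbF.
(* Eliminate [u0] between the two relations and cancel [g]. *)
have key : v0 * (h1 * b - h1^`() * a) = h0 * (v1 * b - u1 * a).
  have E2 : u0 * h1 - v0 * h1^`() = v1 * h0^`() - u1 * h0.
    apply/eqP; rewrite -subr_eq0 -(subrr (v0 * h1^`() + v1 * h0^`())) -[X in _ == X - _]E1.
    by apply/eqP; ring.
  apply: (mulIf gN0); transitivity (v0 * h0^`() * h1 - v0 * h1^`() * h0).
    by rewrite h0'E [in RHS]h0E; ring.
  transitivity ((u0 * h1 - v0 * h1^`()) * h0); first by rewrite -E0; ring.
  by rewrite E2 h0'E [X in v1 * _ - u1 * X]h0E; ring.
(* At a root of [h0] the factor [a] vanishes, while [h1] (by hypothesis) and [b] (coprime to [a]) do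
   not. *)
have cop : coprimep h0 (h1 * b - h1^`() * a).
  apply: Pdiv.ClosedField.root_coprimep => x rx.
  have a0 := rootP (ra x rx); rewrite !hornerE a0 mulr0 subr0 mulf_neq0//.
    exact: rh.
  exact: coprimep_root cab (ra x rx).
by rewrite -(Gauss_dvdpl _ cop) key dvdp_mulr.
Qed.

(** By [dvdp_of_relation] and the size bound the constant term of [V] is zero; then so is that of
    [U], the outer variable cancels from both sides, and induction applies. *)
Lemma gen_relation_eq0 H H' U V : H`_0 != 0 ->
  (forall x, root H`_0 x -> ~~ root H`_1 x) ->
  (forall i, H'`_i = (H`_i)^`()) ->
  (forall i, (size (V`_i)%R < size (H`_0)%R)%N) ->
  U * H = V * H' -> V = 0.
Proof.
move=> HN0 rH dH; elim/poly_ind: V U => [//|V c IH] U sV UH.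
have c0 : c = 0.
  have := congr1 (fun p : {poly {poly k}} => p`_0) UH.
  have := congr1 (fun p : {poly {poly k}} => p`_1) UH.
  rewrite !coefM !big_ord_recl !big_ord0 /= !dH !addr0 => E1 E0.
  have cE : (V * 'X + c%:P)`_0 = c by rewrite coefD coefMX coefC add0r.
  have := dvdp_of_relation HN0 rH E0 E1; rewrite cE => /dvdp_leq hd.
  apply/eqP; apply: contraT => /hd; rewrite leqNgt.
  by have := sV 0; rewrite cE => ->.
rewrite c0 addr0 in sV UH *.
have U0 : U`_0 = 0.
  have := congr1 (fun p : {poly {poly k}} => p`_0) UH.
  rewrite !coefM !big_ord_recl !big_ord0 /=.
  rewrite !addr0 coefMX /= mul0r => /eqP.
  by rewrite mulf_eq0 (negPf HN0) orbF => /eqP.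
have [U' UE] : exists U', U = U' * 'X.
  have /factor_theorem[U' ->] : root U 0 by rewrite rootE horner_coef0 U0.
  by exists U'; rewrite polyC0 subr0.
rewrite (IH U') ?mul0r// => [i|]; first by have := sV i.+1; rewrite coefMX.
have XN0 : 'X != 0 :> {poly {poly k}} by rewrite polyX_eq0.
by apply: (mulIf XN0); rewrite -[LHS]mulrAC -UE UH mulrAC.
Qed.

Lemma dvdp_separable (p q : {poly k}) : separable_poly p ->
  (forall x, root p x -> root q x) -> p %| q.
Proof.
have [r pE] := closed_field_poly_normal p; rewrite [in separable_poly p]pE.
have [->|p0] := eqVneq p 0.
  by rewrite lead_coef0 scale0r unlock derivC /coprimep gcd0p size_poly0.
move=> sp rpq; rewrite pE dvdpZl ?lead_coef_eq0//.
have ur : uniq r.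
  rewrite -separable_prod_XsubC; apply: dvdp_separable sp.
  by rewrite dvdpZr ?lead_coef_eq0.
apply: uniq_roots_dvdp; last by rewrite uniq_rootsE.
apply/allP => x xr; apply: rpq; rewrite pE rootZ ?lead_coef_eq0//.
by rewrite root_prod_XsubC.
Qed.

(* H and R are polynomials in s (outer) and t (inner).  The curve H = 0 is smooth
   along s = 0, so H(s, _) is separable for almost every s. *)
Lemma gen_same_zeros H R (c : k) : c != 0 -> lead_coef (swapXY H) = c%:P ->
  (2 < size (swapXY H))%N -> size (H`_0)%R = size (swapXY H) ->
  (forall x, root H`_0 x -> ~~ root H`_1 x) ->
  (size (swapXY R) < size (swapXY H))%N ->
  (forall s t, root H.[s%:P] t -> root R.[s%:P] t) -> R = 0.
Proof.
move=> c0 lcH szh szH0 rH szR HR; set h := swapXY H in lcH szh szH0 szR.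
have hN0 : h != 0 by rewrite -size_poly_gt0; case: (size h) szh.
have szdh : (size h^`() <= (size h).-1)%N by exact: size_poly.
have dhl : h^`()`_(size h).-2 = c%:P *+ (size h).-1.
  rewrite coef_deriv -lcH lead_coefE; congr (_ `_ _ *+ _);
  by case: (size h) szh => [|[|]].
have szdhE : size h^`() = (size h).-1.
  apply/eqP; rewrite eqn_leq szdh /=.
  rewrite (_ : (size h).-1 = (size h).-2.+1); last by case: (size h) szh => [|[|]].
  rewrite ltnNge; apply/negP => /leq_sizeP/(_ _ (leqnn _)) /eqP.
  rewrite dhl -mulr_natl mulf_eq0 polyC_eq0 (negPf c0) orbF.
  by rewrite -polyC_natr polyC_eq0 pnatr_eq0; case: (size h) szh => [|[|]].
set D := resultant h h^`().
(* A common factor of positive degree in t would give a relation [U * H = V * H'] with [V] coming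
   from [c2 *: q1], nonzero and of too small degree in t for [gen_relation_eq0]. The factors [c1],
   [c2] in k[s] come from pseudo-division. *)
have DN0 : D != 0.
  rewrite resultant_eq0 -leqNgt leqNgt; apply/negP => szg.
  have /Pdiv.Idomain.dvdpP[[c1 q1]/= c1N0 E1] := dvdp_gcdl h h^`().
  have /Pdiv.Idomain.dvdpP[[c2 q2]/= c2N0 E2] := dvdp_gcdr h h^`().
  set g := gcdp _ _ in szg E1 E2.
  have q1N0 : q1 != 0.
    apply: contraNneq hN0 => q10; move/eqP: E1.
    by rewrite q10 mul0r -mul_polyC mulf_eq0 polyC_eq0 (negPf c1N0).
  have szq1 : (size (c2 *: q1) < size h)%N.
    rewrite size_scale// -(size_scale h c1N0) E1 size_mul//; last first.
      by rewrite -size_poly_gt0 (ltn_trans _ szg).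
    by rewrite -(subnKC szg) addnC /= -[X in (X < _)%N]add0n ltn_add2r.
  have E : swapXY (c1 *: q2) * H = swapXY (c2 *: q1) * swapXY h^`().
    rewrite -[H]swapXYK -!rmorphM; congr (swapXY _).
    transitivity (q2 * (c1 *: h)); first by rewrite -!mul_polyC; ring.
    transitivity (q1 * (q2 * g)); first by rewrite E1; ring.
    by rewrite -E2 -!mul_polyC; ring.
  suff /eqP : swapXY (c2 *: q1) = 0.
    by rewrite swapXY_eq0 -mul_polyC mulf_eq0 polyC_eq0 (negPf c2N0) (negPf q1N0).
  apply: gen_relation_eq0 rH _ _ E.
  - by rewrite -size_poly_gt0 szH0 (ltn_trans _ szh).
  - move=> i; apply/polyP => j.
    by rewrite coef_swapXY !coef_deriv coefMn -coef_swapXY swapXYK.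
  - move=> i; rewrite szH0; apply: leq_ltn_trans szq1; apply/leq_sizeP => j lj.
    rewrite coef_swapXY (_ : (c2 *: q1)`_j = 0) ?coef0//; exact: nth_default.
(* Where [D] does not vanish, its Bezout relation specializes to separability of H(s, _), which then
   divides R(s, _), of smaller degree. *)
have RD s : ~~ root D s -> R.[s%:P] = 0.
  move=> Ds; have [[u v]/= _ uvE] : {uv : {poly {poly k}} * {poly {poly k}} |
      (size uv.1 < size h^`())%N /\ (size uv.2 < size h)%N &
      D%:P = uv.1 * h + uv.2 * h^`()}.
    by apply: resultant_in_ideal; rewrite ?szdhE; case: (size h) szh => [|[|[]]].
  have HsE : H.[s%:P] = map_poly (horner_eval s) h by rewrite horner_polyC.
  have szHs : size H.[s%:P] = size h.
    by rewrite HsE size_map_poly_id0// lcH /horner_eval hornerC.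
  have /dvdp_separable/(_ (HR s)) dv : separable_poly H.[s%:P].
    rewrite unlock; apply/Bezout_eq1_coprimepP.
    exists (D.[s]^-1 *: map_poly (horner_eval s) u, D.[s]^-1 *: map_poly (horner_eval s) v).
    rewrite /= -!scalerAl -scalerDr HsE deriv_map -!rmorphM -rmorphD -uvE.
    by rewrite /= map_polyC -mul_polyC -polyCM /= /horner_eval mulVf.
  apply/eqP; apply: contraT => /dvdp_leq/(_ dv); rewrite szHs leqNgt.
  move=> /negP; case; apply: leq_ltn_trans szR.
  by rewrite horner_polyC size_poly.
suff R0 : swapXY R = 0 by rewrite -[R]swapXYK R0 raddf0.
apply/polyP => j; rewrite coef0.
(* Each coefficient of [R] vanishes wherever [D] does not, so its product with [D] vanishes
   everywhere. *)
apply: (mulIf DN0); rewrite mul0r; apply: poly_horner_inj => s.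
rewrite hornerM horner0; have [/rootP ->|/RD] := boolP (root D s).
  by rewrite mulr0.
move=> /(congr1 (fun q : {poly k} => q`_j)).
by rewrite horner_polyC coef_map coef0 /= /horner_eval => ->; rewrite mul0r.
Qed.

End GenericSeparability.

(** * Substituting univariate polynomials into multivariate ones *)

Section MPolySubst.
Variables (n : nat) (R : comNzRingType).
Implicit Type p : mpoly n R.

Lemma mpoly_ring_ind (P : mpoly n R -> Prop) :
  (forall c, P (mpolyC n c)) -> (forall i, P (mpolyX R (mnm1 i))) ->
  (forall p q, P p -> P q -> P (p + q)) ->
  (forall p q, P p -> P q -> P (p * q)) -> forall p, P p.
Proof.
move=> PC PX PD PM; elim/mpolyind => [|c m p _ _ IH]; first by rewrite -mpolyC0.
apply: (PD) => //; rewrite -mul_mpolyC; apply: (PM) => //.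
rewrite mpolyXE_id; apply: (big_ind P) => [|q r|i _]; first by rewrite -mpolyC1.
  exact: PM.
by elim: (m i) => [|e IHe]; rewrite ?expr0 ?exprS -?mpolyC1//; exact: PM.
Qed.

Lemma rmorph_mmap (S T : comNzRingType) (f : {rmorphism R -> S})
    (g : {rmorphism S -> T}) (h : 'I_n -> S) p :
  g (mmap f h p) = mmap (g \o f) (g \o h) p.
Proof.
rewrite /mmap rmorph_sum; apply: eq_bigr => m _; rewrite rmorphM /=.
by congr (_ * _); rewrite rmorph_prod; apply: eq_bigr => i _; rewrite rmorphXn.
Qed.

Lemma eq_mmap (S : comNzRingType) (f g : R -> S) (h1 h2 : 'I_n -> S) p :
  f =1 g -> h1 =1 h2 -> mmap f h1 p = mmap g h2 p.
Proof.
move=> fg h12; rewrite /mmap; apply: eq_bigr => m _; rewrite fg.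
by rewrite (mmap1_eq _ h12).
Qed.

Lemma deriv_mmap (S : comNzRingType) (f : {rmorphism R -> S})
    (h : 'I_n -> {poly S}) p :
  (mmap (polyC \o f) h p)^`() =
  \sum_i mmap (polyC \o f) h (mderiv i p) * (h i)^`().
Proof.
elim/mpoly_ring_ind: p => [c|i|p q IHp IHq|p q IHp IHq].
- rewrite mmapC /= derivC big1// => i _.
  by rewrite mderivC raddf0 mul0r.
- rewrite mmapX mmap1U (bigD1 i)//= big1 ?addr0 => [|j ji].
    rewrite mderivX mnm1E eqxx scale1r.
    have -> : mnm_sub (mnm1 i) (mnm1 i) = mnm0 by apply/mnmP => j; rewrite mnmBE mnm0E subnn.
    by rewrite mmapX mmap11 mul1r.
  by rewrite mderivX mnm1E eq_sym (negPf ji) scale0r raddf0 mul0r.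
- rewrite raddfD /= derivD IHp IHq -big_split; apply: eq_bigr => i _ /=.
  by rewrite mderivD raddfD mulrDl.
- rewrite rmorphM /= derivM IHp IHq mulr_suml mulr_sumr -big_split.
  apply: eq_bigr => i _ /=.
  by rewrite mderivM raddfD /= !rmorphM /=; ring.
Qed.

Lemma size_coef_prod (S : comNzRingType) (I : Type) (r : seq I)
    (h : I -> {poly S}) (c : I -> S) (e : I -> nat) :
  (forall i, (size (h i) <= (e i).+1)%N /\ (h i)`_(e i) = c i) ->
  (size (\prod_(i <- r) h i)%R <= (\sum_(i <- r) e i).+1)%N /\
  (\prod_(i <- r) h i)`_(\sum_(i <- r) e i) = \prod_(i <- r) c i.
Proof.
move=> hc; elim: r => [|i r [IHs IHc]].
  by rewrite !big_nil size_poly1 coefC.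
rewrite !big_cons; have [hs hi] := hc i; split.
  apply: leq_trans (size_polyMleq _ _) _.
  move: (leq_add hs IHs); case: (_ + _)%N => // l.
  by rewrite addSn addnS ltnS.
rewrite coefM (bigD1 (Ordinal (leq_addr (\sum_(j <- r) e j) (e i) : e i < (_ + _).+1)%N)) //=.
rewrite addKn hi IHc [X in _ + X]big1 ?addr0// => j; rewrite -val_eqE /= => ji.
case: (ltngtP (j : nat) (e i)) ji => // lt _; last first.
  by rewrite [(h i)`_j]nth_default ?mul0r// (leq_trans hs).
rewrite [X in _ * X]nth_default ?mulr0//; apply: leq_trans IHs _.
by rewrite ltn_subRL ltn_add2r.
Qed.

(** Each monomial is a product of [d] linear factors, whose top coefficients multiply. Only a size
    bound is possible, as the value at [b] may be zero. The map [f] admits lines with coefficients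
    in [{poly k}], as in [plane_poly_lead]. *)
Lemma mmap_homog_lead (S : comNzRingType) (f : {rmorphism R -> S})
    (a b : 'I_n -> S) d p : p \is ishomog1 d mdeg ->
  let q := mmap (polyC \o f) (fun i => (a i)%:P + (b i)%:P * 'X) p in
  (size q <= d.+1)%N /\ q`_d = mmap f b p.
Proof.
move=> /dhomogP hp q.
have mon m : m \in msupp p ->
    let r := mmap1 (fun i => (a i)%:P + (b i)%:P * 'X) m in
    (size r <= d.+1)%N /\ r`_d = mmap1 b m.
  move=> /hp <- /=; rewrite mdegE.
  apply: (@size_coef_prod S _ _ (fun i => ((a i)%:P + (b i)%:P * 'X) ^+ m i)
            (fun i => b i ^+ m i) (fun i => m i)) => i.
  have lin : (size ((a i)%:P + (b i)%:P * 'X)%R <= 2)%N /\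
             ((a i)%:P + (b i)%:P * 'X)`_1 = b i.
    split; last by rewrite coefD coefMX !coefC add0r.
    apply: leq_trans (size_polyD _ _) _; rewrite geq_max.
    rewrite (leq_trans (size_polyC_leq1 _))// (leq_trans (size_polyMleq _ _))//.
    by rewrite size_polyX addn2 /= ltnS size_polyC_leq1.
  have := @size_coef_prod S _ (nseq (m i) tt) (fun=> (a i)%:P + (b i)%:P * 'X)
     (fun=> b i) (fun=> 1%N) (fun=> lin).
  by rewrite !big_const_seq !count_predT !size_nseq !iter_mulr_1 iter_addn_0 mul1n.
split.
  apply: (leq_trans (size_sum _ _ _)); apply/bigmax_leqP_seq => m /mon[sz _] _.
  by rewrite mul_polyC; exact: leq_trans (size_scale_leq _ _) sz.
rewrite /q /mmap coef_sum; apply: eq_big_seq => m /mon[_ /= <-].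
by rewrite coefCM.
Qed.
End MPolySubst.

Lemma mderiv_homog n (R : numDomainType) d i (p : mpoly n R) :
  p \is ishomog1 d.+1 mdeg -> mderiv i p \is ishomog1 d mdeg.
Proof.
move=> /dhomogP hp; apply/dhomogP => m; rewrite mcoeff_msupp mcoeff_mderiv.
rewrite mulrn_eq0 negb_or /= -mcoeff_msupp => /hp /=.
by rewrite mdegD mdeg1 addn1 => -[].
Qed.

(** * Restriction of forms to lines and planes *)

Section Lines.
Variables (k : numClosedFieldType) (n : nat).
Implicit Types (p q : mpoly n k) (x y z u v w : 'cV[k]_n).

Definition vmeval p x : k := meval (fun i => x i 0) p.

(** The [idfun] gives the shape [polyC \o f] expected by [deriv_mmap] and [mmap_homog_lead]. *)
Definition line_poly p y u : {poly k} :=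
  mmap (polyC \o idfun) (fun i => (y i 0)%:P + (u i 0)%:P * 'X) p.

Lemma horner_line_poly p y u t : (line_poly p y u).[t] = vmeval p (y + t *: u).
Proof.
rewrite -[LHS]/(horner_eval t _) rmorph_mmap; apply: eq_mmap => [c|i] /=.
  by rewrite /horner_eval hornerC.
by rewrite /horner_eval !hornerE !mxE mulrC.
Qed.

Lemma deriv_line_poly p y u :
  (line_poly p y u)^`() = \sum_i line_poly (mderiv i p) y u * (u i 0)%:P.
Proof.
rewrite [LHS]deriv_mmap; apply: eq_bigr => i _.
by rewrite derivD derivC add0r derivM derivC derivX mul0r add0r mulr1.
Qed.

(** The outer variable s moves along [w] and the inner variable t along [u], as in
    [gen_same_zeros]. *)
Definition plane_poly p y w u : {poly {poly k}} :=
  mmap (polyC \o polyC)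
    (fun i => ((y i 0)%:P + (u i 0)%:P * 'X)%:P + ((w i 0)%:P)%:P * 'X) p.

Lemma horner_plane_poly p y w u s :
  (plane_poly p y w u).[s%:P] = line_poly p (y + s *: w) u.
Proof.
rewrite -[LHS]/(horner_eval s%:P _) rmorph_mmap; apply: eq_mmap => [c|i] /=.
  by rewrite /horner_eval hornerC.
by rewrite /horner_eval !hornerE !mxE polyCD polyCM; ring.
Qed.

Lemma plane_poly0 p y w u : (plane_poly p y w u)`_0 = line_poly p y u.
Proof. by rewrite -horner_coef0 -polyC0 horner_plane_poly scale0r addr0. Qed.

Lemma plane_poly1 p y w u : (plane_poly p y w u)`_1 =
  \sum_i line_poly (mderiv i p) y u * (w i 0)%:P.
Proof.
rewrite -[LHS]mulr1n -coef_deriv -horner_coef0 deriv_mmap horner_sum.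
apply: eq_bigr => i _; rewrite hornerM -/(plane_poly _ _ _ _) horner_coef0 plane_poly0.
by rewrite derivD derivC add0r derivM derivC derivX mul0r add0r mulr1 hornerC.
Qed.

(** Swapping the variables turns this into [mmap_homog_lead] over [{poly k}], with direction [u]
    constant in s. *)
Lemma plane_poly_lead p d y w u : p \is ishomog1 d mdeg ->
  (size (swapXY (plane_poly p y w u)) <= d.+1)%N /\
  (swapXY (plane_poly p y w u))`_d = (vmeval p u)%:P.
Proof.
move=> hp; have -> : swapXY (plane_poly p y w u) = mmap (polyC \o polyC)
    (fun i => ((y i 0)%:P + (w i 0)%:P * 'X)%:P + ((u i 0)%:P)%:P * 'X) p.
  rewrite /plane_poly (@rmorph_mmap n k _ _ (polyC \o polyC) (@swapXY k)).
  apply: eq_mmap => [c|i] /=.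
    by rewrite swapXY_polyC map_polyC.
  rewrite !rmorphD !rmorphM /= swapXY_X !swapXY_polyC.
  by rewrite !map_polyC map_polyX /= ?polyCD ?polyCM; ring.
have [sz ->] := @mmap_homog_lead _ _ _ polyC (fun i => (y i 0)%:P + (w i 0)%:P * 'X)
  (fun i => (u i 0)%:P) d p hp.
by split=> //; rewrite /vmeval /meval (rmorph_mmap _ (@polyC k)).
Qed.

Lemma vmevalZ p d (c : k) x : p \is ishomog1 d mdeg ->
  vmeval p (c *: x) = c ^+ d * vmeval p x.
Proof.
move=> /dhomogP hp; rewrite /vmeval !mevalE mulr_sumr; apply: eq_big_seq => m /hp <-.
rewrite mulrCA; congr (_ * _); rewrite /= mdegE -prodrXr -big_split/=.
by apply: eq_bigr => i _; rewrite mxE exprMn.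
Qed.

End Lines.

(** Take [w] on the moment curve (1, t, t^2, ...): each linear form becomes a nonzero polynomial in
    t, and the product of these has a non-root. *)
Lemma avoid_hyperplanes (k : closedFieldType) (n : nat) (I : eqType) (r : seq I)
    (g : I -> 'I_n.+1 -> k) :
  (forall x, x \in r -> exists i, g x i != 0) ->
  exists w : 'cV[k]_n.+1, forall x, x \in r -> \sum_i g x i * w i 0 != 0.
Proof.
move=> gN0; pose P x : {poly k} := \poly_(i < n.+1) g x (inord i).
have : \prod_(x <- r) P x != 0.
  rewrite prodf_seq_neq0; apply/allP => x /gN0[i gi] /=.
  apply: contraNneq gi => /polyP/(_ i).
  by rewrite coef_poly ltn_ord inord_val coef0 => ->.
move=> /closed_nonrootP[t]; rewrite rootE horner_prod prodf_seq_neq0 => /allP rt.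
exists (\col_i t ^+ i) => x xr; have /= := rt x xr.
apply: contraNneq => s0; rewrite horner_poly -[X in _ == X]s0.
by apply/eqP; apply: eq_bigr => i _; rewrite mxE inord_val.
Qed.

(** * Forms vanishing on a smooth hypersurface of the same degree *)

Section SameZeros.
Variables (k : numClosedFieldType) (n d : nat) (p q : mpoly n.+1 k).
Hypotheses (d1 : (1 < d)%N) (hp : p \is ishomog1 d mdeg) (hq : q \is ishomog1 d mdeg).
Hypothesis smooth : forall x : 'cV[k]_n.+1, x != 0 -> vmeval p x = 0 ->
  exists i, vmeval (mderiv i p) x != 0.

Lemma smooth_nonzero : exists x, vmeval p x != 0.
Proof.
apply: contrapT => np; have p0' x : vmeval p x = 0.
  by apply/eqP/negPn/negP => px; apply: np; exists x.
have x1 : const_mx 1 != 0 :> 'cV[k]_n.+1.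
  by apply/eqP => /matrixP/(_ 0 0); rewrite !mxE => /eqP; rewrite oner_eq0.
have [i iN0] := smooth x1 (p0' _).
have l0 : line_poly p (const_mx 1) (delta_mx i 0) = 0.
  by apply: poly_horner_inj => t; rewrite horner_line_poly p0' horner0.
have := congr1 (fun r : {poly k} => r^`().[0]) l0.
rewrite deriv_line_poly deriv0 horner0 horner_sum (bigD1 i)//= big1 => [|j ji].
  rewrite hornerM hornerC mxE !eqxx mulr1 horner_line_poly scale0r !addr0 => e.
  by rewrite e eqxx in iN0.
by rewrite hornerM hornerC mxE (negPf ji) mulr0.
Qed.

(** The constant is read off at a point [u] off the hypersurface. For any other [y], a suitable
    plane through [y] containing the direction [u] reduces the equality at [y] to
    [gen_same_zeros]. *)
Lemma homog_same_zeros :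
  (forall x : 'cV[k]_n.+1, x != 0 -> vmeval p x = 0 -> vmeval q x = 0) ->
  exists c, forall x, vmeval q x = c * vmeval p x.
Proof.
move=> pq; have [u pu] := smooth_nonzero; set c := vmeval q u / vmeval p u.
exists c => y.
have [[x yx]|yu] := pselect (exists x, y + x *: u = 0).
  have -> : y = (- x) *: u by apply/eqP; rewrite scaleNr -addr_eq0 yx.
  by rewrite !(vmevalZ _ _ hp, vmevalZ _ _ hq) /c; field.
pose l := line_poly p y u.
have [r lE] := closed_field_poly_normal l.
have rr x : root l x -> vmeval p (y + x *: u) = 0.
  by move=> /rootP; rewrite horner_line_poly.
have nz x : y + x *: u != 0 by apply/eqP => e; apply: yu; exists x.
(* Choose [w] transversal to the hypersurface at each of its finitely many points on the line
   through [y] in direction [u]. *)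
have [|w wP] := @avoid_hyperplanes k n _ [seq x <- r | root l x]
  (fun x i => vmeval (mderiv i p) (y + x *: u)).
  by move=> x; rewrite mem_filter => /andP[/rr rx _]; exact: smooth.
pose H := plane_poly p y w u; pose Q := plane_poly q y w u - c%:P%:P * H.
have [szH cfH] := plane_poly_lead y w u hp.
have [szQ cfQ] := plane_poly_lead y w u hq.
have szHE : size (swapXY H) = d.+1.
  apply/eqP; rewrite eqn_leq szH ltnNge; apply/negP => /leq_sizeP/(_ d (leqnn d)).
  by rewrite cfH => /eqP; rewrite polyC_eq0 (negPf pu).
have szl : size l = d.+1.
  have [szl cl] := @mmap_homog_lead _ _ _ idfun (fun i => y i 0) (fun i => u i 0) d p hp.
  apply/eqP; rewrite eqn_leq szl ltnNge; apply/negP => /leq_sizeP/(_ d (leqnn d)).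
  by move=> /eqP; rewrite cl; apply/negP.
have l0 : l != 0 by rewrite -size_poly_gt0 szl.
have sQ : swapXY Q = swapXY (plane_poly q y w u) - c%:P%:P * swapXY H.
  by rewrite /Q (raddfB (@swapXY k)) /= (rmorphM (@swapXY k)) /= swapXY_polyC map_polyC.
suff Q0 : Q = 0.
  have := congr1 (fun r : {poly {poly k}} => r.[0%:P].[0]) Q0.
  rewrite polyC0 horner0 hornerD hornerN hornerM !hornerC -polyC0 !horner_plane_poly.
  rewrite hornerD hornerN hornerM hornerC !horner_line_poly !scale0r !addr0.
  by move=> /eqP; rewrite subr_eq0 => /eqP.
apply: (@gen_same_zeros k H Q (vmeval p u)) => //.
- by rewrite lead_coefE szHE cfH.
- by rewrite szHE.
- by rewrite szHE plane_poly0 -/l szl.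
- move=> x; rewrite plane_poly0 plane_poly1 -/l => rx.
  rewrite rootE horner_sum.
  under eq_bigr do rewrite hornerM hornerC horner_line_poly.
  apply: wP; rewrite mem_filter rx /=; move: rx; rewrite lE rootZ ?lead_coef_eq0//.
  by rewrite root_prod_XsubC.
(* The choice of [c] cancels the coefficients of t^d. *)
- rewrite szHE ltnS; apply/leq_sizeP => j; rewrite leq_eqVlt => /predU1P[<-|dj].
    rewrite sQ coefB cfQ coefCM cfH.
    by rewrite -polyCM /c divfK// subrr.
  rewrite sQ coefB coefCM.
  rewrite [X in X - _](leq_sizeP _ _ szQ)// [X in _ * X](leq_sizeP _ _ szH)//.
  by rewrite mulr0 subrr.
- move=> s t; rewrite !rootE hornerD hornerN hornerM !hornerC !horner_plane_poly.
  rewrite hornerD hornerN hornerM hornerC !horner_line_poly.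
  (* The plane may pass through the origin, where [pq] says nothing; there both forms vanish by
     homogeneity. *)
  have [-> _|z0 /eqP pz] := eqVneq (y + s *: w + t *: u) 0.
    rewrite -[0](scale0r 0) !(vmevalZ _ _ hp, vmevalZ _ _ hq) expr0n.
    by case: (d) d1 => // ? _; rewrite !mul0r mulr0 subrr.
  by rewrite pz mulr0 subr0 pq.
Qed.
End SameZeros.

Section LinearSubstitution.
Variables (k : numClosedFieldType) (n : nat).
Implicit Types (p : mpoly n k) (A : 'M[k]_n).

Definition mpoly_mx p A : mpoly n k :=
  comp_mpoly [tuple \sum_j A i j *: mpolyX k (mnm1 j) | i < n] p.

Lemma vmeval_mpoly_mx p A x : vmeval (mpoly_mx p A) x = vmeval p (A *m x).
Proof.
rewrite /vmeval comp_mpoly_meval; apply: meval_eq => i.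
rewrite tnth_mktuple raddf_sum mxE; apply: eq_bigr => j _.
by rewrite /= mevalZ mevalXU.
Qed.

Lemma mpoly_mx_homog p A d : p \is ishomog1 d mdeg -> mpoly_mx p A \is ishomog1 d mdeg.
Proof.
move=> /dhomogP hp; rewrite /mpoly_mx /comp_mpoly /mmap.
rewrite big_seq; apply: rpred_sum => m /hp /= <-.
rewrite mul_mpolyC; apply: dhomogZ; rewrite mdegE /mmap1.
apply: (big_ind2 (fun (q : mpoly n k) e => q \is ishomog1 e mdeg)).
- exact: dhomog1.
- by move=> q1 e1 q2 e2; apply: dhomogM.
move=> i _; rewrite -[X in ishomog1 X]mul1n; apply: dhomogMn.
rewrite tnth_mktuple; apply: rpred_sum => j _; apply: dhomogZ.
by rewrite dhomogX; apply/eqP; exact: mdeg1.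
Qed.

End LinearSubstitution.

(** * Automorphisms of a smooth hypersurface as semi-invariance of its equation *)

Section ProjectiveAutomorphisms.
Local Open Scope quotient_scope.
Variables (k : numClosedFieldType) (n d : nat) (p : mpoly n.+1 k).
Hypotheses (d1 : (1 < d)%N) (hp : p \is ishomog1 d mdeg).
Hypothesis p_smooth : singular_locus p = set0.

Lemma singular_locus0P x : x != 0 -> vmeval p x = 0 ->
  exists i, vmeval (mderiv i p) x != 0.
Proof.
move=> x0 px; pose v := MkNzvec x0.
have pv : zero_locus p (\pi_(projspace k n) v) by apply/(zero_locusE _ hp).
have : ~ singular_locus p (\pi_(projspace k n) v) by rewrite p_smooth.
have [c c0 vc] := projspace_reprP v.
move=> ns; have /existsNP[i /eqP ni] : ~ forall i,
    meval (coords (\pi_(projspace k n) v)) (mderiv i p) = 0.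
  by move=> h; apply: ns; split.
exists i; apply: contraNneq ni => di.
have hd : mderiv i p \is ishomog1 d.-1 mdeg.
  by apply: mderiv_homog; case: (d) d1 hp.
rewrite (_ : meval _ _ = vmeval (mderiv i p) (c *: x)).
  by rewrite (vmevalZ _ _ hd) di mulr0.
by apply: meval_eq => j; rewrite /coords vc.
Qed.

(** For the direct implication, [homog_same_zeros] compares [p] with its substitution by [A], which
    vanishes on the zeros of [p]. *)
Lemma projAutP (A : GL k n.+1) :
  projAut (zero_locus p) (\pi_(PGL k n.+1) A) <->
  exists2 c, c != 0 & forall x, vmeval p (GLmx A *m x) = c * vmeval p x.
Proof.
split=> [AX|[c c0 Ac]].
  have hz x : x != 0 -> vmeval p x = 0 -> vmeval (mpoly_mx p A) x = 0.
    move=> x0 px; rewrite vmeval_mpoly_mx; pose v := MkNzvec x0.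
    apply/(zero_locusE (GL_act A v) hp); rewrite -PGL_actE -AX.
    by exists (\pi_(projspace k n) v) => //; apply/(zero_locusE v hp).
  have [c cE] := homog_same_zeros d1 hp (mpoly_mx_homog A hp) singular_locus0P hz.
  exists c => [|x]; last by rewrite -cE vmeval_mpoly_mx.
  have [x px] := smooth_nonzero singular_locus0P.
  apply: contraNneq px => c0; have := cE (invmx A *m x).
  by rewrite vmeval_mpoly_mx (mulKVmx (Defs.GL_unit A)) c0 mul0r => /eqP.
rewrite /projAut/=; apply/seteqP; split=> [_ [x + <-]|].
  elim/quotW: x => v /(zero_locusE v hp) pv; rewrite PGL_actE.
  by apply/(zero_locusE _ hp); rewrite [LHS]Ac [X in _ * X]pv mulr0.
move=> x; elim/quotW: x => v /(zero_locusE v hp) pv.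
exists (\pi_(projspace k n) (GL_act (GL_inv A) v)).
  apply/(zero_locusE _ hp); apply/eqP; rewrite -(mulrI_eq0 _ (mulfI c0)).
  by apply/eqP; rewrite -[LHS]Ac (mulKVmx (Defs.GL_unit A)).
by rewrite PGL_actE; congr (\pi_ _ _); apply: val_inj; rewrite /= (mulKVmx (Defs.GL_unit A)).
Qed.

End ProjectiveAutomorphisms.

(** * Linear automorphisms of the Klein-type quintics *)

(** The cases are written with [inord] so that [inord5_succ] and [inord5_eq] can compute indices
    modulo 5. *)
Lemma ord5_ind (P : 'I_5 -> Prop) :
  P (inord 0) -> P (inord 1) -> P (inord 2) -> P (inord 3) -> P (inord 4) ->
  forall i, P i.
Proof.
move=> ? ? ? ? ? i; rewrite -(inord_val i); case: i => -[|[|[|[|[|]]]]] //.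
Qed.

Lemma inord5_succ a : (a < 5)%N -> inord a + 1 = inord (a.+1 %% 5) :> 'I_5.
Proof.
by case: a => [|[|[|[|[|]]]]] // _; apply: val_inj; rewrite /= !inordK.
Qed.

Lemma inord5_eq a b : (a < 5)%N -> (b < 5)%N ->
  (inord a == inord b :> 'I_5) = (a == b).
Proof. by move=> a5 b5; rewrite -val_eqE /= !inordK. Qed.

Lemma sum_ord5 (R : nmodType) (f : 'I_5 -> R) :
  \sum_i f i = f (inord 0) + f (inord 1) + f (inord 2) + f (inord 3) + f (inord 4).
Proof.
rewrite !big_ord_recr big_ord0 /= add0r.
by do ![congr (_ + _)]; congr f; apply: val_inj; rewrite /= inordK.
Qed.

Lemma prod_ord5 (R : pzSemiRingType) (f : 'I_5 -> R) :
  \prod_i f i = f (inord 0) * f (inord 1) * f (inord 2) * f (inord 3) * f (inord 4).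
Proof.
rewrite !big_ord_recr big_ord0 /= mul1r.
by do ![congr (_ * _)]; congr f; apply: val_inj; rewrite /= inordK.
Qed.

(** * Second derivatives of the Klein-type quintics *)

Section KleinForm.
Variable k : numClosedFieldType.
Implicit Types (x y v : 'cV[k]_5) (lam : k).

Definition klein lam x : k :=
  \sum_i x i 0 ^+ 4 * x (i + 1) 0 + lam * \prod_i x i 0.

Lemma kleinE lam x : klein lam x =
  x (inord 0) 0 ^+ 4 * x (inord 1) 0 + x (inord 1) 0 ^+ 4 * x (inord 2) 0 +
  x (inord 2) 0 ^+ 4 * x (inord 3) 0 + x (inord 3) 0 ^+ 4 * x (inord 4) 0 +
  x (inord 4) 0 ^+ 4 * x (inord 0) 0 +
  lam * (x (inord 0) 0 * x (inord 1) 0 * x (inord 2) 0 * x (inord 3) 0 * x (inord 4) 0).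
Proof. by rewrite /klein sum_ord5 prod_ord5 !inord5_succ. Qed.

(* For a quintic F this is the coefficient of s^2 in F (x + s v), extracted by
   finite differences. *)
Definition polar2 (F : 'cV[k]_5 -> k) x v : k :=
  (8%:R * (F (x + v) + F (x - v)) -
   (F (x + v + v) + F (x - v - v)) / 2%:R - 15%:R * F x) / 12%:R.

(** The pairs of variables differentiated in the product are grouped by cyclic distance 1 or 2. *)
Lemma klein_polar2 lam x v : polar2 (klein lam) x v =
  \sum_i (6%:R * v i 0 ^+ 2 * (x i 0 ^+ 2 * x (i + 1) 0) +
          4%:R * (v i 0 * v (i + 1) 0) * x i 0 ^+ 3) +
  lam * \sum_i (v i 0 * v (i + 1) 0 * (x (i + 2) 0 * x (i + 3) 0 * x (i + 4) 0) +
                v i 0 * v (i + 2) 0 * (x (i + 1) 0 * x (i + 3) 0 * x (i + 4) 0)).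
Proof.
have s2 (i : 'I_5) : i + 2 = i + 1 + 1 by ring.
have s3 (i : 'I_5) : i + 3 = i + 1 + 1 + 1 by ring.
have s4 (i : 'I_5) : i + 4 = i + 1 + 1 + 1 + 1 by ring.
rewrite /polar2 !kleinE !mxE !sum_ord5 !(s2, s3, s4) !inord5_succ//.
by field.
Qed.

(** On a coordinate plane [lam] disappears, since each of its terms involves three distinct
    coordinates of x. *)
Lemma klein_polar2_two lam v i j a b : i != j ->
  polar2 (klein lam) (a *: delta_mx i 0 + b *: delta_mx j 0) v =
  4%:R * (v i 0 * v (i + 1) 0) * a ^+ 3 + 4%:R * (v j 0 * v (j + 1) 0) * b ^+ 3 +
  (j == i + 1)%:R * (6%:R * v i 0 ^+ 2 * (a ^+ 2 * b)) +
  (i == j + 1)%:R * (6%:R * v j 0 ^+ 2 * (b ^+ 2 * a)).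
Proof.
have s2 (l : 'I_5) : l + 2 = l + 1 + 1 by ring.
have s3 (l : 'I_5) : l + 3 = l + 1 + 1 + 1 by ring.
have s4 (l : 'I_5) : l + 4 = l + 1 + 1 + 1 + 1 by ring.
rewrite klein_polar2 !sum_ord5 !(s2, s3, s4) !inord5_succ// !mxE.
by elim/ord5_ind: i; elim/ord5_ind: j; rewrite !inord5_succ// !inord5_eq//= => _;
  ring.
Qed.

(** Compare coefficients on all coordinate planes. If some v_i is nonzero with m_i = 0, the
    equations force l_j = 0, hence v_j = 0, for all other j. Otherwise nonvanishing propagates from
    v_i to v_{i+1}, and two indices at cyclic distance 2 give a contradiction. *)
Lemma klein_polar2_factor lam v (l m : 'cV[k]_5) : v != 0 ->
  (forall x, polar2 (klein lam) x v =
    (\sum_i l i 0 * x i 0) ^+ 2 * (\sum_i m i 0 * x i 0)) ->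
  exists i, forall j, j != i -> v j 0 = 0.
Proof.
move=> v0 fac.
have lin (u : 'cV[k]_5) i j a b : i != j ->
    \sum_h u h 0 * (a *: delta_mx i 0 + b *: delta_mx j 0 : 'cV[k]_5) h 0 =
    u i 0 * a + u j 0 * b.
  move=> ij; rewrite (bigD1 i)//= (bigD1 j) 1?eq_sym//= big1 => [|h /andP[hi hj]].
    by rewrite !mxE !eqxx (negPf ij) eq_sym (negPf ij) /=; ring.
  by rewrite !mxE (negPf hi) (negPf hj) /= !mulr0 addr0 mulr0.
have two i j a b : i != j -> 4%:R * (v i 0 * v (i + 1) 0) * a ^+ 3 +
    4%:R * (v j 0 * v (j + 1) 0) * b ^+ 3 +
    (j == i + 1)%:R * (6%:R * v i 0 ^+ 2 * (a ^+ 2 * b)) +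
    (i == j + 1)%:R * (6%:R * v j 0 ^+ 2 * (b ^+ 2 * a)) =
    (l i 0 * a + l j 0 * b) ^+ 2 * (m i 0 * a + m j 0 * b).
  by move=> ij; rewrite -(klein_polar2_two lam v a b ij) fac !lin.
have succN (i : 'I_5) : (i == i + 1) = false.
  by elim/ord5_ind: i; rewrite inord5_succ// inord5_eq.
have succ2N (i : 'I_5) : (i == i + 1 + 1) = false.
  by elim/ord5_ind: i; rewrite !inord5_succ// inord5_eq.
have E1 i : l i 0 ^+ 2 * m i 0 = 4%:R * (v i 0 * v (i + 1) 0).
  have ii : i != i + 1 by rewrite succN.
  transitivity ((l i 0 * 1 + l (i + 1) 0 * 0) ^+ 2 * (m i 0 * 1 + m (i + 1) 0 * 0)).
    by ring.
  by rewrite -(two i (i + 1) 1 0 ii); ring.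
(* The coefficient of a^2 b, isolated from the values at (1, 1) and (1, -1) after removing the b^3
   term by [E1]. *)
have E2 i j : i != j -> l i 0 * (2%:R * l j 0 * m i 0 + l i 0 * m j 0) =
    (j == i + 1)%:R * (6%:R * v i 0 ^+ 2).
  move=> ij; have n2 : (2%:R : k) != 0 by rewrite pnatr_eq0.
  apply: (mulfI n2).
  transitivity ((l i 0 * 1 + l j 0 * 1) ^+ 2 * (m i 0 * 1 + m j 0 * 1) -
     (l i 0 * 1 + l j 0 * (-1)) ^+ 2 * (m i 0 * 1 + m j 0 * (-1)) -
     2%:R * (l j 0 ^+ 2 * m j 0)); first by ring.
  by rewrite -!two// E1; ring.
have lN0 i : v i 0 != 0 -> l i 0 != 0.
  move=> vi; apply: contraNneq vi => li; have := E2 i (i + 1).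
  rewrite succN eqxx li mul0r mul1r => /(_ isT)/esym/eqP.
  by rewrite mulf_eq0 pnatr_eq0 /= sqrf_eq0.
have [[i [vi mi]]|ex] := pselect (exists i, v i 0 != 0 /\ m i 0 = 0).
  exists i; have li := lN0 _ vi.
  have mS : m (i + 1) 0 != 0.
    apply: contraNneq vi => mS; have := E2 i (i + 1).
    rewrite succN eqxx mi mS !mulr0 addr0 mulr0 mul1r => /(_ isT)/esym/eqP.
    by rewrite mulf_eq0 pnatr_eq0 /= sqrf_eq0.
  have l0 j : j != i -> l j 0 = 0.
    move=> ji; have [->|jS] := eqVneq j (i + 1).
      have := E2 (i + 1) i; rewrite eq_sym succN succ2N mi mulr0 addr0 mul0r.
      move=> /(_ isT)/eqP; rewrite !mulf_eq0 pnatr_eq0 (negPf li) (negPf mS) /=.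
      by rewrite !orbF => /eqP.
    have mj : m j 0 = 0.
      have := E2 i j; rewrite eq_sym ji (negPf jS) mi mulr0 add0r mul0r.
      move=> /(_ isT)/eqP; rewrite !mulf_eq0 (negPf li) /=.
      by move=> /eqP.
    have := E2 j (i + 1) jS; rewrite mj mulr0 add0r.
    rewrite (inj_eq (addIr 1)) eq_sym (negPf ji) mul0r => /eqP.
    by rewrite !mulf_eq0 (negPf mS) orbF orbb => /eqP.
  move=> j ji; apply/eqP; apply: contraT => /lN0.
  by rewrite l0 ?eqxx.
have mN0 i : v i 0 != 0 -> m i 0 != 0.
  by move=> vi; apply/eqP => mi; apply: ex; exists i.
have vS i : v i 0 != 0 -> v (i + 1) 0 != 0.
  move=> vi; apply: contraTneq (mN0 _ vi) => vS; have /eqP := E1 i.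
  by rewrite vS !mulr0 mulf_eq0 sqrf_eq0 (negPf (lN0 _ vi)) /= => ->.
have [i vi] : exists i, v i 0 != 0.
  have [[i vi]|vz] := pselect (exists i, v i 0 != 0); first by exists i.
  move: v0; rewrite (_ : v = 0) ?eqxx//; apply/matrixP => i j; rewrite ord1 mxE.
  by apply/eqP/negPn/negP => vi; apply: vz; exists i.
pose j : 'I_5 := i + 1 + 1; have vj : v j 0 != 0 by rewrite !vS.
have ij : i != j by rewrite succ2N.
have jS : (j == i + 1) = false.
  by rewrite /j; elim/ord5_ind: (i); rewrite !inord5_succ// inord5_eq.
have iS : (i == j + 1) = false.
  by rewrite /j; elim/ord5_ind: (i); rewrite !inord5_succ// inord5_eq.
have /eqP := E2 i j ij; rewrite jS mul0r mulf_eq0 (negPf (lN0 _ vi)) /= => /eqP e1.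
have ji : j != i by rewrite eq_sym.
have /eqP := E2 j i ji; rewrite iS mul0r mulf_eq0 (negPf (lN0 _ vj)) /= => /eqP e2.
(* The two relations 2 l_j m_i + l_i m_j = 0 and 2 l_i m_j + l_j m_i = 0 have determinant 3. *)
have : 3%:R * (l j 0 * m i 0) = 0.
  transitivity (2%:R * (2%:R * l j 0 * m i 0 + l i 0 * m j 0) -
                (2%:R * l i 0 * m j 0 + l j 0 * m i 0)); first by ring.
  by rewrite e1 e2 mulr0 subr0.
move=> /eqP; rewrite !mulf_eq0 pnatr_eq0 /= => /orP[] /eqP z.
  by have := lN0 _ vj; rewrite z eqxx.
by have := mN0 _ vi; rewrite z eqxx.
Qed.
End KleinForm.

(** * Linear symmetries of the Klein-type form are monomial *)

Section KleinMonomial.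
Variable k : numClosedFieldType.
Implicit Types (x y v : 'cV[k]_5) (lam : k).

Lemma klein_two lam (i j : 'I_5) (a b : k) : i != j ->
  klein lam (a *: delta_mx i 0 + b *: delta_mx j 0) =
  (j == i + 1)%:R * (a ^+ 4 * b) + (i == j + 1)%:R * (b ^+ 4 * a).
Proof.
rewrite kleinE !mxE.
by elim/ord5_ind: i; elim/ord5_ind: j; rewrite !inord5_succ// !inord5_eq//= => _;
  ring.
Qed.

Lemma klein_delta lam (i : 'I_5) (a : k) : klein lam (a *: delta_mx i 0) = 0.
Proof.
by rewrite kleinE !mxE; elim/ord5_ind: i; rewrite !inord5_eq//=; ring.
Qed.

Lemma polar2_mulmx (F : 'cV[k]_5 -> k) (A : 'M[k]_5) c :
  (forall x, F (A *m x) = c * F x) ->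
  forall x v, polar2 F (A *m x) (A *m v) = c * polar2 F x v.
Proof. by move=> FA x v; rewrite /polar2 -!mulmxDr -!mulmxBr !FA; field. Qed.

(** Basis vectors do give cubics l^2 m, a converse to [klein_polar2_factor]. *)
Lemma klein_polar2_delta lam x i : polar2 (klein lam) x (delta_mx i 0) =
  6%:R * (x i 0 ^+ 2 * x (i + 1) 0).
Proof.
have s2 (l : 'I_5) : l + 2 = l + 1 + 1 by ring.
have s3 (l : 'I_5) : l + 3 = l + 1 + 1 + 1 by ring.
have s4 (l : 'I_5) : l + 4 = l + 1 + 1 + 1 + 1 by ring.
rewrite klein_polar2 !sum_ord5 !(s2, s3, s4) !inord5_succ// !mxE.
by elim/ord5_ind: i; rewrite !inord5_succ// !inord5_eq//=; ring.
Qed.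

(** [A] preserves the directions whose cubic is l^2 m, so it permutes the axes; the values of the
    form on the planes spanned by e_i and e_{i+1} show that the permutation is a cyclic shift. *)
Lemma klein_monomial lam (A : 'M[k]_5) c : A \in unitmx -> c != 0 ->
  (forall x, klein lam (A *m x) = c * klein lam x) ->
  exists (s : 'I_5) (a : 'I_5 -> k), forall i,
    A *m delta_mx i 0 = a i *: (delta_mx (i + s) 0 : 'cV[k]_5) /\
    a i ^+ 4 * a (i + 1) = c.
Proof.
move=> uA c0 AK.
have Ad0 i : A *m (delta_mx i 0 : 'cV[k]_5) != 0.
  apply: contraTneq isT => Ad; have := congr1 (mulmx (invmx A)) Ad.
  rewrite mulKmx// mulmx0 => /matrixP/(_ i 0); rewrite !mxE !eqxx /= => /eqP.
  by rewrite oner_eq0.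
have /boolp.choice[s sP] : forall i, exists h, forall j, j != h ->
    (A *m (delta_mx i 0 : 'cV[k]_5)) j 0 = 0.
  (* The forms l and m are rows i and i+1 of the inverse of [A], the second scaled by 6c. *)
  move=> i; apply: (@klein_polar2_factor k lam _ (\col_h invmx A i h)
    (\col_h (6%:R * c * invmx A (i + 1) h)) (Ad0 i)) => x.
  rewrite -{1}(mulKVmx uA x) (polar2_mulmx AK) klein_polar2_delta.
  have -> : \sum_h (\col_h invmx A i h) h 0 * x h 0 = (invmx A *m x) i 0.
    by rewrite mxE; apply: eq_bigr => h _; rewrite mxE.
  have -> : \sum_h (\col_h (6%:R * c * invmx A (i + 1) h)) h 0 * x h 0 =
      6%:R * c * (invmx A *m x) (i + 1) 0.
    by rewrite mxE mulr_sumr; apply: eq_bigr => h _; rewrite mxE mulrA.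
  by ring.
pose a i := (A *m (delta_mx i 0 : 'cV[k]_5)) (s i) 0.
have AE i : A *m delta_mx i 0 = a i *: (delta_mx (s i) 0 : 'cV[k]_5).
  apply/matrixP => j l; rewrite ord1 [in RHS]mxE [in RHS]mxE.
  have [->|/sP ->] := eqVneq j (s i); first by rewrite mulr1.
  by rewrite mulr0.
have succN (i : 'I_5) : (i == i + 1) = false.
  by elim/ord5_ind: i; rewrite inord5_succ// inord5_eq.
have succ2N (i : 'I_5) : (i == i + 1 + 1) = false.
  by elim/ord5_ind: i; rewrite !inord5_succ// inord5_eq.
have key i : s (i + 1) = s i + 1 /\ a i ^+ 4 * a (i + 1) = c.
  have ii : i != i + 1 by rewrite succN.
  have H t : klein lam ((t * a i) *: delta_mx (s i) 0 + a (i + 1) *: delta_mx (s (i + 1)) 0) =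
      c * t ^+ 4.
    rewrite -scalerA -!AE -[X in _ + X]scale1r !scalemxAr -mulmxDr AK klein_two//.
    by rewrite eqxx succ2N /=; ring.
  have [e|sN] := eqVneq (s i) (s (i + 1)).
    have := H 1; rewrite e -scalerDl klein_delta expr1n mulr1 => /esym/eqP.
    by rewrite (negPf c0).
  have [e|sN1] := eqVneq (s (i + 1)) (s i + 1).
    have := H 1; rewrite klein_two// e eqxx succ2N expr1n mulr1 /= => <-; split=> //.
    by ring.
  (* If the shift fails, the left side of [H] is linear in t, against c t^4 on the right; t = 1 and
     t = 2 give 16c = 2c. *)
  have H1 := H 1; have H2 := H 2%:R.
  rewrite !klein_two// (negPf sN1) in H1 H2.
  have : 14%:R * c = 0.
    transitivity (c * 2%:R ^+ 4 - 2%:R * (c * 1 ^+ 4)); first by ring.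
    by rewrite -H1 -H2 /=; ring.
  by move=> /eqP; rewrite mulf_eq0 pnatr_eq0 (negPf c0).
exists (s 0), a => i; split; last by case: (key i).
rewrite AE; congr (_ *: delta_mx _ 0).
have sS j : s (j + 1) = s j + 1 by case: (key j).
have i0 : inord 0 = 0 :> 'I_5 by apply: val_inj; rewrite /= inordK.
have iS j : (j < 4)%N -> inord j.+1 = inord j + 1 :> 'I_5.
  by move=> j4; rewrite inord5_succ ?modn_small// ltnW.
by elim/ord5_ind: i; rewrite ?iS// ?sS i0; ring.
Qed.

End KleinMonomial.

(** * Normal form of a quintic with an automorphism of order 41 *)

Section FiniteOrderMatrices.
Variable k : numClosedFieldType.

Lemma prime_unity_primitive m (z : k) : prime m -> z ^+ m = 1 -> z != 1 ->
  m.-primitive_root z.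
Proof.
move=> pm zm z1; have [d zd] := prim_order_exists (prime_gt0 pm) zm.
have /primeP[_ h] := pm => /h /orP[]/eqP dE; last by rewrite -dE.
by move: z1; rewrite -[z]expr1 -{1}dE (prim_expr_order zd) eqxx.
Qed.

(** The minimal polynomial divides X^m - 1, which is separable. The diagonalization of the library
    acts on rows, hence the passage to [invmx P] for column eigenvectors. *)
Lemma unity_root_diag n m (B : 'M[k]_n.+1) : (0 < m)%N -> B ^+ m = 1 ->
  exists (Q : 'M[k]_n.+1) (b : 'rV[k]_n.+1),
    [/\ Q \in unitmx, B *m Q = Q *m diag_mx b & forall i, b 0 i ^+ m = 1].
Proof.
move=> m0 Bm.
have [r rE] := closed_field_poly_normal ('X^m - 1 : {poly k}).
rewrite lead_coefXnsubC// scale1r in rE.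
have [P Pu /diagonalizable_forPex[b]] : diagonalizable B.
  apply/diagonalizableP; exists r.
    rewrite -separable_prod_XsubC -rE.
    by rewrite separable_Xn_sub_1// pnatr_eq0 -lt0n.
  rewrite -rE; apply: mxminpoly_min.
  by rewrite rmorphB rmorph1 rmorphXn /= horner_mx_X Bm subrr.
move=> /(simmxP Pu) PB.
have BQ : B *m invmx P = invmx P *m diag_mx b.
  by apply: (can_inj (mulKmx Pu)); rewrite mulmxA PB mulKVmx// mulmxK.
exists (invmx P), b; split=> // [|i]; first by rewrite unitmx_inv.
have Bcol : B *m col i (invmx P) = b 0 i *: col i (invmx P).
  rewrite [in LHS]colE mulmxA BQ -[in LHS]colE; apply/matrixP => j l.
  by rewrite mul_mx_diag !mxE mulrC.
have step h : B ^+ h *m col i (invmx P) = b 0 i ^+ h *: col i (invmx P).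
  elim: h => [|h IH]; first by rewrite !expr0 mul1mx scale1r.
  by rewrite exprSr -mulmxE -mulmxA Bcol -scalemxAr IH scalerA -exprS.
have := step m; rewrite Bm mul1mx => e.
have c0 : col i (invmx P) != 0.
  apply: contraTneq isT => c0; have : P *m col i (invmx P) = 0 by rewrite c0 mulmx0.
  by rewrite colE mulmxA mulmxV// -colE => /matrixP/(_ i 0)/eqP; rewrite !mxE eqxx oner_eq0.
have : (b 0 i ^+ m - 1) *: col i (invmx P) = 0 by rewrite scalerBl scale1r -e subrr.
by move=> /eqP; rewrite scaler_eq0 (negPf c0) orbF subr_eq0 => /eqP.
Qed.

End FiniteOrderMatrices.

Section LiftOrder.
Local Open Scope quotient_scope.
Variables (k : numClosedFieldType) (n : nat).

Lemma PGL_exp (A : GL k n.+1) m : exists2 B : GL k n.+1,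
  ((\pi_(PGL k n.+1) A : PGL k n.+1) ^+ m)%g = \pi_(PGL k n.+1) B &
  GLmx B = (GLmx A : 'M[k]_n.+1) ^+ m.
Proof.
elim: m => [|m [B BE BA]].
  by exists (GL_one k n.+1) => //; rewrite expg0.
exists (GL_mul A B); last by rewrite /= BA exprS.
by rewrite expgS BE; exact: PGL_mulE.
Qed.

(** A fifth root of 1/c rescales [A] into a matrix fixing [p]. Its 41st power is then a scalar [mu']
    with mu'^5 = 1, and since 41 is 1 modulo 5, dividing by [mu'] makes the order 41 without
    disturbing [p]. *)
Lemma lift_order41 (p : mpoly n.+1 k) (A : GL k n.+1) (c : k) :
  p \is ishomog1 5 mdeg -> (exists x, vmeval p x != 0) ->
  has_order (\pi_(PGL k n.+1) A : PGL k n.+1) 41 -> c != 0 ->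
  (forall x, vmeval p (GLmx A *m x) = c * vmeval p x) ->
  exists B : 'M[k]_n.+1,
    [/\ B ^+ 41 = 1, B != 1 & forall x, vmeval p (B *m x) = vmeval p x].
Proof.
move=> hp [x0 px0] [_ A41 A1] c0 Ac.
have [A' A'E AA'] := PGL_exp A 41.
have [mu mu0 muE] : exists2 mu, mu != 0 & (GLmx A : 'M_n.+1) ^+ 41 = mu%:M.
  have /PGL_eqP[mu mu0 muE] : \pi_(PGL k n.+1) A' == \pi_(PGL k n.+1) (GL_one k n.+1).
    by rewrite -A'E A41.
  by exists mu; rewrite // -AA' muE /= scalemx1.
set nu := 5.-root c^-1; have nu5 : nu ^+ 5 = c^-1 by rewrite rootCK.
have nu0 : nu != 0.
  apply: contraTneq isT => e; move: nu5; rewrite e expr0n => /esym/eqP.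
  by rewrite invr_eq0 (negPf c0).
set B1 := nu *: (GLmx A : 'M_n.+1).
have FB1 x : vmeval p (B1 *m x) = vmeval p x.
  by rewrite /B1 -scalemxAl (vmevalZ _ _ hp) Ac nu5 mulKf.
have FB1X m x : vmeval p (B1 ^+ m *m x) = vmeval p x.
  by elim: m => [|m IH]; rewrite ?expr0 ?mul1mx// exprS -mulmxE -mulmxA FB1.
set mu' := nu ^+ 41 * mu.
have B1E : B1 ^+ 41 = mu'%:M by rewrite exprZn muE scale_scalar_mx.
have mu'0 : mu' != 0 by rewrite mulf_neq0// expf_neq0.
have mu'5 : mu' ^+ 5 = 1.
  have := FB1X 41%N x0; rewrite B1E mul_scalar_mx (vmevalZ _ _ hp) => e.
  by apply: (mulIf px0); rewrite mul1r.
exists (mu'^-1 *: B1); split.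
- rewrite exprZn B1E scale_scalar_mx exprVn (_ : 41 = 1 + 5 * 8)%N//.
  by rewrite exprD exprM mu'5 expr1n mulr1 expr1 mulVf.
- apply/eqP => B1'; apply: (A1 1%N) => //; rewrite expg1; apply/eqP/PGL_eqP.
  have s0 : mu'^-1 * nu != 0 by rewrite mulf_neq0// invr_eq0.
  exists (mu'^-1 * nu)^-1; first by rewrite invr_eq0.
  rewrite /= -[1%:M]/(1 : 'M_n.+1) -B1' /B1 !scalerA -mulrA mulVf ?scale1r//.
- by move=> x; rewrite -scalemxAl (vmevalZ _ _ hp) FB1 exprVn mu'5 invr1 mul1r.
Qed.

End LiftOrder.

Section Gradient.
Variables (k : numClosedFieldType) (n : nat) (p : mpoly n k).
Implicit Types (x w : 'cV[k]_n).

Definition vderiv x w : k := \sum_i vmeval (mderiv i p) x * w i 0.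

Lemma vderiv_line x w : vderiv x w = (line_poly p x w)^`().[0].
Proof.
rewrite deriv_line_poly horner_sum; apply: eq_bigr => i _.
by rewrite hornerM hornerC horner_line_poly scale0r addr0.
Qed.

Lemma vderiv_sum (I : Type) (r : seq I) x (c : I -> k) (w : I -> 'cV[k]_n) :
  vderiv x (\sum_(j <- r) c j *: w j) = \sum_(j <- r) c j * vderiv x (w j).
Proof.
rewrite /vderiv; under [RHS]eq_bigr do rewrite mulr_sumr.
rewrite exchange_big; apply: eq_bigr => i _.
by rewrite summxE mulr_sumr; apply: eq_bigr => j _; rewrite mxE mulrCA.
Qed.

End Gradient.

(* The residues of (-4)^i modulo 41. *)
Definition klein_wt (i : 'I_5) : nat := nth 0%N [:: 1; 37; 16; 18; 10]%N i.

(** Here 37 stands for -4 modulo 41. *)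
Lemma klein_wt_succ (F : fieldType) (z : F) i : z ^+ 41 = 1 ->
  (z ^+ klein_wt i) ^+ 37 = z ^+ klein_wt (i + 1).
Proof.
move=> z41; rewrite -exprM -(expr_mod _ z41) -[RHS](expr_mod _ z41); congr (_ ^+ _).
by rewrite /klein_wt; elim/ord5_ind: i; rewrite inord5_succ// !inordK.
Qed.

(** * The eigenbasis of the element of order 41 *)

Section InvariantFrame.
Variables (k : numClosedFieldType) (p : mpoly 5 k).
Hypothesis hp : p \is ishomog1 5 mdeg.
Hypothesis p_smooth : forall x : 'cV[k]_5, x != 0 -> vmeval p x = 0 ->
  exists i, vmeval (mderiv i p) x != 0.
Variable B : 'M[k]_5.
Hypotheses (B41 : B ^+ 41 = 1) (B1 : B != 1).
Hypothesis FB : forall x, vmeval p (B *m x) = vmeval p x.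

(** The derivative has degree 4 in the point and degree 1 in the direction. *)
Lemma vderiv_eigen (u v : 'cV[k]_5) a b : B *m u = a *: u -> B *m v = b *: v ->
  vderiv p u v = a ^+ 4 * b * vderiv p u v.
Proof.
move=> Bu Bv; have h i : mderiv i p \is ishomog1 4 mdeg by exact: mderiv_homog.
have line : line_poly p u v = line_poly p (a *: u) (b *: v).
  apply: poly_horner_inj => t; rewrite !horner_line_poly -FB -Bu -Bv.
  by rewrite mulmxDr scalemxAr.
rewrite {1}vderiv_line line -vderiv_line /vderiv mulr_sumr.
by apply: eq_bigr => i _; rewrite (vmevalZ _ _ (h i)) mxE; ring.
Qed.

(** If [p] does not vanish at the eigenvector, j = i works and the second claim is vacuous;
    otherwise smoothness provides an eigenvector along which the derivative is nonzero. *)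
Lemma smooth_weight (Q : 'M[k]_5) b i : Q \in unitmx ->
  (forall j, B *m col j Q = b j *: col j Q) ->
  exists j, b i ^+ 4 * b j = 1 /\ (j != i -> vderiv p (col i Q) (col j Q) != 0).
Proof.
move=> uQ Bcol.
have uiN0 : col i Q != 0.
  apply: contraTneq isT => c0; have : invmx Q *m col i Q = 0 by rewrite c0 mulmx0.
  by rewrite colE mulmxA mulVmx// -colE => /matrixP/(_ i 0)/eqP; rewrite !mxE eqxx oner_eq0.
have [F0|F0] := eqVneq (vmeval p (col i Q)) 0; last first.
  exists i; rewrite eqxx; split=> //; apply: (mulIf F0).
  by rewrite mul1r -[RHS]FB Bcol (vmevalZ _ _ hp) -exprSr.
have [h hN0] := p_smooth uiN0 F0.
have [j jN0] : exists j, vderiv p (col i Q) (col j Q) != 0.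
  apply: contrapT => nj; move: hN0.
  have dh : vderiv p (col i Q) (delta_mx h 0) = vmeval (mderiv h p) (col i Q).
    rewrite /vderiv (bigD1 h)//= big1 ?addr0 => [|l lh].
      by rewrite mxE !eqxx mulr1.
    by rewrite mxE (negPf lh) mulr0.
  have dE : delta_mx h 0 = \sum_j invmx Q j h *: col j Q.
    rewrite -[LHS](mulKVmx uQ); apply/matrixP => a b'; rewrite ord1 mxE summxE.
    apply: eq_bigr => j _; rewrite -colE !mxE.
    by rewrite mulrC.
  rewrite -dh dE vderiv_sum big1 ?eqxx// => j _.
  have [->|jN] := eqVneq (vderiv p (col i Q) (col j Q)) 0; first by rewrite mulr0.
  by case: nj; exists j.
exists j; split=> //; have := vderiv_eigen (Bcol i) (Bcol j).
by rewrite -[X in X = _]mul1r => /(mulIf jN0).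
Qed.

(** Starting from an eigenvalue other than 1, iterate the choice of j in [smooth_weight]: the
    exponents run through the powers of -4 modulo 41, five distinct values, so the iterates exhaust
    the eigenbasis. *)
Lemma invariant_frame : exists (M : 'M[k]_5) (z : k),
  [/\ M \in unitmx, 41.-primitive_root z,
      forall i, B *m col i M = z ^+ klein_wt i *: col i M &
      forall i, vderiv p (col i M) (col (i + 1) M) != 0].
Proof.
have [Q [b0 [uQ BQ b41]]] := unity_root_diag (isT : (0 < 41)%N) B41.
pose b i := b0 0 i.
have Bcol j : B *m col j Q = b j *: col j Q.
  rewrite [in LHS]colE mulmxA BQ -[in LHS]colE; apply/matrixP => a l.
  by rewrite mul_mx_diag !mxE mulrC.
have [i0 bi0] : exists i0, b i0 != 1.
  apply: contrapT => nb; move: B1; rewrite (_ : B = 1) ?eqxx//.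
  have -> : B = B *m Q *m invmx Q by rewrite mulmxK.
  rewrite BQ (_ : diag_mx b0 = 1%:M) ?mulmx1 ?mulmxV//.
  rewrite -diag_const_mx; congr diag_mx; apply/rowP => i; rewrite mxE.
  by apply/eqP/negPn/negP => bi; apply: nb; exists i.
have zP : 41.-primitive_root (b i0) by apply: prime_unity_primitive.
set z := b i0 in zP.
have /boolp.choice[f fP] : forall i, exists j, b i ^+ 4 * b j = 1 /\
    (j != i -> vderiv p (col i Q) (col j Q) != 0).
  by move=> i; exact: smooth_weight.
have inv4 i (a : k) : b i ^+ 4 * a = 1 -> a = b i ^+ 37.
  move=> e; have := b41 i; rewrite -/(b i) (_ : 41 = 4 + 37)%N// exprD => e2.
  have bi0N : b i ^+ 4 != 0.
    by apply: contraTneq isT => e0; move: e; rewrite e0 mul0r => /esym/eqP; rewrite oner_eq0.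
  by apply: (mulfI bi0N); rewrite e e2.
have bf i : b (f i) = b i ^+ 37 by apply: inv4; case: (fP i).
pose s (i : 'I_5) := iter i f i0.
have bs_nat m : (m < 5)%N -> b (iter m f i0) = z ^+ klein_wt (inord m).
  elim: m => [_|m IH m5]; first by rewrite /klein_wt inordK.
  rewrite iterS bf IH 1?ltnW// klein_wt_succ ?(prim_expr_order zP)//.
  by rewrite inord5_succ ?modn_small// ltnW.
have bs i : b (s i) = z ^+ klein_wt i by rewrite bs_nat// inord_val.
have wt_inj i j : z ^+ klein_wt i = z ^+ klein_wt j -> i = j.
  move=> /eqP; rewrite (eq_prim_root_expr zP).
  by rewrite /klein_wt; elim/ord5_ind: i; elim/ord5_ind: j; rewrite !inordK.
have s_inj : injective s by move=> i j /(congr1 b); rewrite !bs => /wt_inj.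
(* As [s] is onto, [f (s i)] is some [s h], and the distinct eigenvalues determine [h]; this also
   closes the cycle at i = 4. *)
have fs i : f (s i) = s (i + 1).
  have /codomP[h hE] : f (s i) \in codom s.
    by rewrite (inj_card_onto s_inj)// card_ord.
  rewrite hE; congr s; apply: wt_inj; rewrite -!bs -hE bf bs -exprM.
  rewrite bs; apply/eqP; rewrite (eq_prim_root_expr zP) /klein_wt.
  by elim/ord5_ind: i {hE}; rewrite inord5_succ// !inordK.
pose M := col_perm (perm s_inj) Q.
have colM i : col i M = col (s i) Q.
  by apply/matrixP => a l; rewrite !mxE permE.
exists M, z; split=> // [|i|i].
- by rewrite /M col_permE unitmx_mul uQ unitmx_perm.
- by rewrite !colM Bcol bs.
- rewrite !colM -fs; have [_] := fP (s i); apply; rewrite fs (inj_eq s_inj).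
  by elim/ord5_ind: i; rewrite inord5_succ// inord5_eq.
Qed.
End InvariantFrame.

Lemma klein_weights (m : 'I_5 -> nat) : (\sum_i m i = 5)%N ->
  (41 %| \sum_i klein_wt i * m i)%N ->
  (forall i, m i = 1%N) \/
  exists i, forall j, m j = ((j == i) * 4 + (j == (i + 1)%R))%N.
Proof.
pose t (a b c d e : nat) := (a + b + c + d + e == 5)%N ==>
  (41 %| 1 * a + 37 * b + 16 * c + 18 * d + 10 * e)%N ==>
  ([:: a; b; c; d; e] \in [:: [:: 1; 1; 1; 1; 1]; [:: 4; 1; 0; 0; 0];
    [:: 0; 4; 1; 0; 0]; [:: 0; 0; 4; 1; 0]; [:: 0; 0; 0; 4; 1]; [:: 1; 0; 0; 0; 4]])%N.
have T a b c d e : t a b c d e.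
  have chk : all (fun a => all (fun b => all (fun c => all (fun d => all (t a b c d)
    (iota 0 6)) (iota 0 6)) (iota 0 6)) (iota 0 6)) (iota 0 6) by vm_compute.
  have [le|] := boolP (a + b + c + d + e == 5)%N; last by rewrite /t => /negPf ->.
  have in6 x y : (x + y = 5 -> x \in iota 0 6)%N.
    by move=> xy; rewrite mem_iota /= add0n ltnS -xy leq_addr.
  move/eqP: le => le.
  have a6 : a \in iota 0 6 by apply: (in6 _ (b + c + d + e)%N); rewrite -le; ring.
  have b6 : b \in iota 0 6 by apply: (in6 _ (a + c + d + e)%N); rewrite -le; ring.
  have c6 : c \in iota 0 6 by apply: (in6 _ (a + b + d + e)%N); rewrite -le; ring.
  have d6 : d \in iota 0 6 by apply: (in6 _ (a + b + c + e)%N); rewrite -le; ring.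
  have e6 : e \in iota 0 6 by apply: (in6 _ (a + b + c + d)%N); rewrite -le; ring.
  by move: chk => /allP/(_ a a6)/allP/(_ b b6)/allP/(_ c c6)/allP/(_ d d6)/allP/(_ e e6).
rewrite !sum_ord5 /klein_wt !inordK//= => s5 d41.
have := T (m (inord 0)) (m (inord 1)) (m (inord 2)) (m (inord 3)) (m (inord 4)).
move=> /implyP/(_ (introT eqP s5))/implyP/(_ d41).
rewrite !inE => /or4P[|||/or3P[||]] /eqP[e0 e1 e2 e3 e4].
- by left; elim/ord5_ind.
- by right; exists (inord 0); elim/ord5_ind; rewrite inord5_succ// !inord5_eq.
- by right; exists (inord 1); elim/ord5_ind; rewrite inord5_succ// !inord5_eq.
- by right; exists (inord 2); elim/ord5_ind; rewrite inord5_succ// !inord5_eq.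
- by right; exists (inord 3); elim/ord5_ind; rewrite inord5_succ// !inord5_eq.
- by right; exists (inord 4); elim/ord5_ind; rewrite inord5_succ// !inord5_eq.
Qed.

(** * Invariant quintics and their normal form *)

Section InvariantQuintic.
Variable k : numClosedFieldType.

Definition wklein (c : 'I_5 -> k) (lam : k) (y : 'cV[k]_5) : k :=
  \sum_i c i * (y i 0 ^+ 4 * y (i + 1) 0) + lam * \prod_i y i 0.

Lemma unity_geometric_sum m (z : k) w : (0 < m)%N -> m.-primitive_root z ->
  \sum_(t < m) (z ^+ w) ^+ t = m%:R * (m %| w)%N%:R.
Proof.
move=> m0 zP; rewrite (prim_order_dvd zP); case: eqP => [->|/eqP r1].
  by rewrite mulr1 (eq_bigr (fun=> 1)) ?sumr_const ?card_ord// => t _; rewrite expr1n.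
rewrite mulr0; have r10 : z ^+ w - 1 != 0 by rewrite subr_eq0.
by apply: (mulfI r10); rewrite mulr0 -subrX1 exprAC (prim_expr_order zP) expr1n subrr.
Qed.

(* Averaging over the powers of the diagonal matrix kills the other monomials. *)
Lemma invariant_quintic (q : mpoly 5 k) (z : k) : q \is ishomog1 5 mdeg ->
  41.-primitive_root z ->
  (forall y : 'cV[k]_5, vmeval q (\col_i (z ^+ klein_wt i * y i 0)) = vmeval q y) ->
  exists c lam, forall y, vmeval q y = wklein c lam y.
Proof.
move=> hq zP inv.
pose mon (m : multinom 5) (y : 'cV[k]_5) := \prod_i y i 0 ^+ m i.
pose w (m : multinom 5) := (\sum_i klein_wt i * m i)%N.
have inv_t t (y : 'cV[k]_5) : vmeval q (\col_i (z ^+ (klein_wt i * t) * y i 0)) = vmeval q y.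
  elim: t => [|t IH].
    by congr vmeval; apply/colP => i; rewrite mxE muln0 mul1r.
  rewrite -IH -[RHS]inv; congr vmeval; apply/colP => i.
  by rewrite !mxE mulnS exprD mulrA.
have mon_t m t (y : 'cV[k]_5) : mon m (\col_i (z ^+ (klein_wt i * t) * y i 0)) =
    mon m y * (z ^+ w m) ^+ t.
  rewrite /mon /w expr_sum -prodrXl -big_split; apply: eq_bigr => i _ /=.
  by rewrite mxE exprMn mulrC -!exprM mulnAC.
have n41 : (41%:R : k) != 0 by rewrite pnatr_eq0.
have avg y : vmeval q y = \sum_(m <- msupp q) mcoeff m q * mon m y * (41 %| w m)%N%:R.
  apply: (mulfI n41); transitivity (\sum_(t < 41) vmeval q y).
    by rewrite sumr_const card_ord mulr_natl.
  transitivity (\sum_(t < 41) \sum_(m <- msupp q) mcoeff m q * mon m y * (z ^+ w m) ^+ t).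
    apply: eq_bigr => t _; rewrite -(inv_t t) /vmeval mevalE; apply: eq_bigr => m _.
    by rewrite -mulrA -mon_t.
  rewrite exchange_big mulr_sumr; apply: eq_bigr => m _ /=.
  by rewrite -mulr_sumr unity_geometric_sum// mulrCA.
suff [c [lam H]] : exists c lam, forall y,
    \sum_(m <- msupp q) mcoeff m q * mon m y * (41 %| w m)%N%:R = wklein c lam y.
  by exists c, lam => y; rewrite avg.
(* Each surviving monomial adds its coefficient either to [lam] or to a single [c i]. *)
have /dhomogP := hq; elim: (msupp q) => [|m s IH] hs.
  exists (fun=> 0), 0 => y; rewrite big_nil /wklein big1 => [|i _].
    by rewrite mul0r addr0.
  by rewrite mul0r.
have [m' ms|c [lam IHs]] := IH; first by apply: hs; rewrite inE ms orbT.
have m5 : (\sum_i m i)%N = 5%N by rewrite -mdegE; apply: hs; rewrite inE eqxx.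
have [d41|n41m] := boolP (41 %| w m)%N; last first.
  by exists c, lam => y; rewrite big_cons (negPf n41m) mulr0 add0r.
have [m1|[i mi]] := klein_weights m5 d41.
  exists c, (lam + mcoeff m q) => y; rewrite big_cons IHs d41 mulr1 /wklein.
  have -> : mon m y = \prod_i y i 0 by apply: eq_bigr => i _; rewrite m1.
  by ring.
exists (fun j => c j + mcoeff m q * (j == i)%:R), lam => y.
rewrite big_cons IHs d41 mulr1 /wklein.
have -> : mon m y = y i 0 ^+ 4 * y (i + 1) 0.
  rewrite /mon prod_ord5 !mi; elim/ord5_ind: i {mi};
    by rewrite !inord5_succ// !inord5_eq//=; ring.
rewrite [in RHS](bigD1 i)//= [in LHS](bigD1 i)//= eqxx.
under [in RHS]eq_bigr => j ji do rewrite (negPf ji) mulr0 addr0.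
by rewrite mulr1; ring.
Qed.

End InvariantQuintic.

Section NormalForm.
Variable k : numClosedFieldType.

(* Eliminating d_1, ..., d_4 leaves an equation d_0^(1 + 4^5) = K. *)
Lemma klein_rescaling (c : 'I_5 -> k) : (forall i, c i != 0) ->
  exists d : 'I_5 -> k, forall i, c i * (d i ^+ 4 * d (i + 1)) = 1.
Proof.
move=> c0; pose C n := c (inord n); have C0 n : C n != 0 by exact: c0.
(* The alternating powers of 4 arise from substituting each equation into the next. *)
pose K := (C 4 / C 3 ^+ 4 * C 2 ^+ 16 / C 1 ^+ 64 * C 0 ^+ 256)^-1.
pose x := 1025.-root K; have xK : x ^+ 1024 * x = K.
  by rewrite -exprSr; apply: (@rootCK k 1025).
have K0 : K != 0 by rewrite invr_eq0 !mulf_neq0 ?invr_eq0 ?expf_neq0.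
have x0 : x != 0 by apply: contraNneq K0 => e; rewrite -xK e mulr0.
pose d1 := (C 0 * x ^+ 4)^-1; pose d2 := (C 1 * d1 ^+ 4)^-1.
pose d3 := (C 2 * d2 ^+ 4)^-1; pose d4 := (C 3 * d3 ^+ 4)^-1.
have d10 : d1 != 0 by rewrite invr_eq0 mulf_neq0 ?expf_neq0.
have d20 : d2 != 0 by rewrite invr_eq0 mulf_neq0 ?expf_neq0.
have d30 : d3 != 0 by rewrite invr_eq0 mulf_neq0 ?expf_neq0.
have E1 : d1 ^+ 256 = (C 0 ^+ 256 * x ^+ 1024)^-1 by rewrite exprVn exprMn -exprM.
have E2 : d2 ^+ 64 = (C 1 ^+ 64 * d1 ^+ 256)^-1 by rewrite exprVn exprMn -exprM.
have E3 : d3 ^+ 16 = (C 2 ^+ 16 * d2 ^+ 64)^-1 by rewrite exprVn exprMn -exprM.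
have E4 : d4 ^+ 4 = (C 3 ^+ 4 * d3 ^+ 16)^-1 by rewrite exprVn exprMn -exprM.
exists (fun i => nth 0 [:: x; d1; d2; d3; d4] i).
elim/ord5_ind; rewrite inord5_succ// !inordK//=.
- by rewrite -/(C 0) mulrA mulfV// mulf_neq0 ?expf_neq0.
- by rewrite -/(C 1) mulrA mulfV// mulf_neq0 ?expf_neq0.
- by rewrite -/(C 2) mulrA mulfV// mulf_neq0 ?expf_neq0.
- by rewrite -/(C 3) mulrA mulfV// mulf_neq0 ?expf_neq0.
rewrite -/(C 4) E4 E3 E2 E1 -[RHS](mulVf K0) -{2}xK /K.
have : x ^+ 1024 != 0 by rewrite expf_neq0.
have := expf_neq0 256 (C0 0); have := expf_neq0 64 (C0 1).
have := expf_neq0 16 (C0 2); have := expf_neq0 4 (C0 3); have := C0 4.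
(* The large powers become atoms, so that [field] does not expand them. *)
move: (C 4) (C 3 ^+ 4) (C 2 ^+ 16) (C 1 ^+ 64) (C 0 ^+ 256) (x ^+ 1024).
move=> a4 a3 a2 a1 a0 X h4 h3 h2 h1 h0 hX.
by field; rewrite hX h0 h1 h2 h3 h4.
Qed.

Lemma klein_normal_form (p : mpoly 5 k) (B : 'M[k]_5) : p \is ishomog1 5 mdeg ->
  (forall x : 'cV[k]_5, x != 0 -> vmeval p x = 0 ->
     exists i, vmeval (mderiv i p) x != 0) ->
  B ^+ 41 = 1 -> B != 1 -> (forall x, vmeval p (B *m x) = vmeval p x) ->
  exists2 P : 'M[k]_5, P \in unitmx &
    exists lam, forall y, vmeval p (P *m y) = klein lam y.
Proof.
move=> hp smooth B41 B1 FB.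
have [M [z [uM zP Bcol dM]]] := invariant_frame hp smooth B41 B1 FB.
have BM y : B *m (M *m y) = M *m (\col_i (z ^+ klein_wt i * y i 0)).
  rewrite mulmxA; apply/colP => a; rewrite !mxE; apply: eq_bigr => i _.
  have /matrixP/(_ a 0) := Bcol i; rewrite [in LHS]colE mulmxA -[in LHS]colE !mxE => ->.
  by ring.
have [|c [lam cE]] := invariant_quintic (mpoly_mx_homog M hp) zP.
  by move=> y; rewrite !vmeval_mpoly_mx -BM FB.
have FM y : vmeval p (M *m y) = wklein c lam y by rewrite -cE vmeval_mpoly_mx.
(* Along e_i + t e_{i+1} the form is c_i t, so c_i is the derivative that the frame makes
   nonzero. *)
have c0 i : c i != 0.
  suff <- : vderiv p (col i M) (col (i + 1) M) = c i by exact: dM.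
  rewrite vderiv_line (_ : line_poly _ _ _ = c i *: 'X).
    by rewrite derivZ derivX hornerZ hornerC mulr1.
  apply: poly_horner_inj => t; rewrite horner_line_poly !colE scalemxAr -mulmxDr FM.
  rewrite hornerZ hornerX /wklein sum_ord5 prod_ord5 !inord5_succ// !mxE.
  by elim/ord5_ind: i; rewrite inord5_succ// !inord5_eq//=; ring.
have [d dE] := klein_rescaling c0.
have d0 i : d i != 0.
  apply: contraTneq isT => di; have := dE i; rewrite di expr0n mul0r mulr0 => /esym/eqP.
  by rewrite oner_eq0.
exists (M *m diag_mx (\row_i d i)).
  by rewrite unitmx_mul uM unitmxE det_diag unitfE; apply/prodf_neq0 => i _; rewrite mxE.
exists (lam * \prod_i d i) => y; rewrite -mulmxA FM /wklein /klein.
congr (_ + _).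
  apply: eq_bigr => i _; rewrite mul_diag_mx !mxE.
  by rewrite -[RHS]mul1r -(dE i); ring.
rewrite -mulrA -big_split; congr (_ * _); apply: eq_bigr => i _ /=.
by rewrite mul_diag_mx !mxE.
Qed.
End NormalForm.

(** * The automorphism group *)

(** Translation by [t] generates a p-group of permutations of [S] without common fixed points, so
    the number of points is 0 modulo [p]. *)
Lemma finite_free_translation (G : groupType) (S : set G) (t : G) (p : nat) :
  prime p -> finite_set S -> (t ^+ p = 1)%g -> t <> 1%g ->
  (forall x, S x -> S (t * x)%g) ->
  exists2 n : nat, (S #= `I_n)%card & (p %| n)%N.
Proof.
move=> pp fS tp t1 tS.
pose T : finType := fset_set S.
have mulT (x : T) : (t * val x)%g \in fset_set S.
  rewrite in_fset_set//; apply/mem_set/tS/set_mem; rewrite -in_fset_set//.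
  exact: valP.
pose f (x : T) : T := [` mulT x]%fset.
have f_inj : injective f.
  by move=> x y /(congr1 val) /= /mulgI /val_inj.
pose s := perm f_inj.
have sX m (x : T) : val ((s ^+ m)%g x) = (t ^+ m * val x)%g.
  elim: m => [|m IH]; first by rewrite expg0 perm1 expg0 mul1g.
  by rewrite expgSr permM permE /= IH expgS mulgA.
have sp : (s ^+ p)%g = 1%g.
  by apply/permP => x; apply: val_inj; rewrite sX tp mul1g perm1.
have pG : (p.-group <[s]>)%g.
  by apply: (@pnat_dvd _ p); rewrite ?pnat_id// -[#|_|]/(#[s]%g) order_dvdn sp.
have acts : ([acts <[s]>, on [set: T]%SET | 'P])%g.
  by apply/actsP => a _ x; rewrite !finset.inE.
have := pgroup_fix_mod pG acts; rewrite finset.cardsT.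
rewrite (_ : ('Fix_([set: T]%SET | 'P)(<[s]>))%g = finset.set0).
  rewrite finset.cards0 mod0n => /eqP; rewrite -/(dvdn _ _).
  have /finite_setP[n Sn] := fS.
  by rewrite -cardfE => pn; exists #|` fset_set S| => //; rewrite (card_fset_set Sn).
apply/eqP; rewrite finset.eqEsubset finset.sub0set andbT; apply/fintype.subsetP => x.
rewrite finset.inE => /andP[_ /afixP/(_ s (cycle_id s))] /= /(congr1 val).
rewrite apermE permE /= => e; case: t1; apply: (mulIg (val x)).
by rewrite mul1g.
Qed.

(** * Roots of unity, and the generators as projective classes *)

Section KleinGroup.
Local Open Scope quotient_scope.
Variable R : realType.
Local Notation C := R[i].

Lemma xi_exp m n : xi R m ^+ n =
  Complex (cos (2 * pi / m%:R * n%:R)) (sin (2 * pi / m%:R * n%:R)).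
Proof.
elim: n => [|n IH]; first by rewrite expr0 mulr0 cos0 sin0.
rewrite exprSr IH /xi; set t := 2 * pi / _.
rewrite (_ : t * n.+1%:R = t * n%:R + t); last by rewrite -natr1 mulrDr mulr1.
rewrite cosD sinD.
by apply/eqP; rewrite eq_complex /= eqxx /= addrC eqxx.
Qed.

Lemma xi_primitive m : prime m -> (2 < m)%N -> m.-primitive_root (xi R m).
Proof.
move=> pm m2; apply: prime_unity_primitive => //.
  have m0 : m%:R != 0 :> R by rewrite pnatr_eq0 -lt0n prime_gt0.
  by rewrite xi_exp divfK// mulrC mulr_natr cos2pi sin2pi.
(* The imaginary part is positive, as 2 < m puts the angle strictly between 0 and pi. *)
apply/eqP => -[_ /eqP]; rewrite gt_eqF//; apply: sin_gt0_pi.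
have mp : 0 < m%:R :> R by rewrite ltr0n prime_gt0.
rewrite divr_gt0 ?mulr_gt0 ?pi_gt0//= ltr_pdivrMr// mulrC ltr_pM2l ?pi_gt0//.
by rewrite ltr_nat.
Qed.

Definition pcycle : PGL C 5 := \pi_(PGL C 5) (MkGL (cycle_unit R)).

Definition pdiag (a : 'I_5 -> C) (a0 : forall j, a j != 0) : PGL C 5 :=
  \pi_(PGL C 5) (MkGL (diag_unit a0)).

Lemma diag_mx_exp n (a : 'I_n.+1 -> C) m :
  (diag_mx (\row_j a j) : 'M_n.+1) ^+ m = diag_mx (\row_j a j ^+ m).
Proof.
elim: m => [|m IH]; last first.
  rewrite exprS IH -mulmxE mulmx_diag; congr diag_mx; apply/rowP => j.
  by rewrite !mxE exprS.
rewrite expr0 -[LHS]diag_const_mx; congr diag_mx; apply/rowP => j.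
by rewrite !mxE expr0.
Qed.

Lemma pdiag_exp_eq (a b : 'I_5 -> C) a0 b0 n m (s : C) : s != 0 ->
  (forall j, a j ^+ n = s * b j ^+ m) ->
  (@pdiag a a0 ^+ n = @pdiag b b0 ^+ m)%g.
Proof.
move=> s0 ab; have [A -> AE] := PGL_exp (MkGL (diag_unit a0)) n.
have [B -> BE] := PGL_exp (MkGL (diag_unit b0)) m.
apply/eqP/PGL_eqP; exists s => //; rewrite AE BE /= !diag_mx_exp.
by rewrite -linearZ; congr diag_mx; apply/rowP => j; rewrite !mxE.
Qed.

Lemma cycle_exp_delta n (i : 'I_5) :
  cycle_mx R ^+ n *m (delta_mx i 0 : 'cV_5) = delta_mx (i - n%:R) 0.
Proof.
elim: n i => [|n IH] i; first by rewrite expr0 mul1mx subr0.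
rewrite exprSr -mulmxE -mulmxA.
have -> : cycle_mx R *m (delta_mx i 0 : 'cV_5) = delta_mx (i - 1) 0.
  rewrite -[in LHS](subrK 1 i); move: (i - 1) => j.
  rewrite -colE; apply/colP => r; rewrite !mxE andbT; congr (_%:R).
  by elim/ord5_ind: j; elim/ord5_ind: r; rewrite inord5_succ// inord5_eq// !inordK.
by rewrite IH -natr1 opprD addrCA addrC.
Qed.

Lemma pcycle_exp5 : (pcycle ^+ 5 = 1)%g.
Proof.
have [A AE AA] := PGL_exp (MkGL (cycle_unit R)) 5.
rewrite /pcycle AE; apply/eqP/PGL_eqP; exists 1; rewrite ?oner_eq0// scale1r.
rewrite AA; apply/matrixP => i j.
have /matrixP/(_ i 0) := cycle_exp_delta 5 j; rewrite -colE !mxE => ->.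
by rewrite (_ : 5%:R = 0 :> 'I_5) ?subr0 ?andbT//; apply: val_inj.
Qed.

Lemma pcycle_neq1 : pcycle <> 1%g.
Proof.
move=> /eqP/PGL_eqP[c c0 /matrixP/(_ 0 0)] /eqP.
by rewrite !mxE /= eq_sym mulr1 (negPf c0).
Qed.

Lemma klein_cycle lam (x : 'cV[C]_5) : klein lam (cycle_mx R *m x) = klein lam x.
Proof.
have cx i : (cycle_mx R *m x) i 0 = x (i + 1) 0.
  rewrite mxE (bigD1 (i + 1))//= big1 => [|j ji].
    rewrite mxE addr0 (_ : (_ == _)%N = true) ?mul1r//.
    by elim/ord5_ind: i; rewrite inord5_succ// !inordK.
  rewrite mxE (_ : (_ == _)%N = false) ?mul0r//; apply: contraNF ji => /eqP e.
  by apply/eqP/ord_inj; rewrite e; elim/ord5_ind: i {e}; rewrite inord5_succ// !inordK.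
rewrite /klein; congr (_ + _ * _).
  by rewrite [RHS](reindex_inj (addIr 1)); apply: eq_bigr => i _; rewrite !cx.
by rewrite [RHS](reindex_inj (addIr 1)); apply: eq_bigr => i _; rewrite !cx.
Qed.

End KleinGroup.

(** * Diagonal symmetries *)

Section KleinDiagonal.
Variable R : realType.
Local Notation C := R[i].

Definition pdiag5 : PGL C 5 := pdiag (@diag5_neq0 R).
Definition pdiag41 : PGL C 5 := pdiag (@diag41_neq0 R).

Lemma ord5_cycle_ind (P : 'I_5 -> Prop) : P 0 -> (forall i, P i -> P (i + 1)) ->
  forall i, P i.
Proof.
move=> P0 PS; have i0 : inord 0 = 0 :> 'I_5 by apply: val_inj; rewrite /= inordK.
have iS j : (j < 4)%N -> inord j.+1 = inord j + 1 :> 'I_5.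
  by move=> j4; rewrite inord5_succ ?modn_small// ltnW.
by elim/ord5_ind; rewrite ?iS// i0; do ?apply: (PS).
Qed.

Lemma diag5_succ i : diag5 R (i + 1) = diag5 R i * xi R 5.
Proof.
have z5 : xi R 5 ^+ 5 = 1 by apply: prim_expr_order; exact: xi_primitive.
rewrite /diag5 -exprSr.
by elim/ord5_ind: i; rewrite inord5_succ// !inordK.
Qed.

Lemma diag41E j : diag41 R j = xi R 41 ^+ klein_wt j.
Proof.
have z41 : xi R 41 ^+ 41 = 1 by apply: prim_expr_order; exact: xi_primitive.
rewrite /diag41 /klein_wt; elim/ord5_ind: j; rewrite inordK//=.
rewrite -[LHS]/((xi R 41 ^+ 4)^-1) -[LHS]mul1r -z41 (_ : 41 = 37 + 4)%N// exprD mulfK//.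
by rewrite expf_neq0 ?xi_neq0.
Qed.

Lemma pdiag41_exp : (pdiag41 ^+ 41 = 1)%g.
Proof.
have z41 : xi R 41 ^+ 41 = 1 by apply: prim_expr_order; exact: xi_primitive.
rewrite -[RHS](expg0 pdiag41); apply: (pdiag_exp_eq _ _ (s := 1)) => [|j].
  exact: oner_neq0.
by rewrite diag41E exprAC z41 expr1n mul1r.
Qed.

Lemma pdiag5_exp : (pdiag5 ^+ 5 = 1)%g.
Proof.
have z5 : xi R 5 ^+ 5 = 1 by apply: prim_expr_order; exact: xi_primitive.
rewrite -[RHS](expg0 pdiag5); apply: (pdiag_exp_eq _ _ (s := 1)) => [|j].
  exact: oner_neq0.
by rewrite /diag5 exprAC z5 expr1n mul1r.
Qed.

(** After rescaling, b_{i+1} = b_i^(-4), so going once around the cycle gives b_0^1025 = 1 with 1025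
    = 25 * 41. The 25th power of the class is a power of [pdiag41], the 41st a power of [pdiag5]. *)
Lemma klein_diag (a : 'I_5 -> C) (a0 : forall j, a j != 0) c : c != 0 ->
  (forall i, a i ^+ 4 * a (i + 1) = c) ->
  exists l m, pdiag a0 = (pdiag41 ^+ l * pdiag5 ^+ m)%g.
Proof.
move=> c0 ac; set nu := 5.-root c^-1; have nu5 : nu ^+ 5 = c^-1 by rewrite rootCK.
have nu0 : nu != 0.
  apply: contraTneq isT => e; move: nu5; rewrite e expr0n => /esym/eqP.
  by rewrite invr_eq0 (negPf c0).
pose b i := nu * a i; have b0 i : b i != 0 by rewrite mulf_neq0.
have bS i : b (i + 1) = (b i ^+ 4)^-1.
  apply: (mulfI (expf_neq0 4 (b0 i))); rewrite mulfV ?expf_neq0//.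
  rewrite /b exprMn mulrACA -exprSr ac nu5.
  by rewrite mulVf.
have b1025 : b 0 ^+ 25 ^+ 41 = 1.
  have E (x : C) m : (x ^+ 4)^-1 ^+ m = (x ^+ (4 * m))^-1 by rewrite exprVn exprM.
  have e5 : (0 : 'I_5) + 1 + 1 + 1 + 1 + 1 = 0 by apply: val_inj.
  rewrite -exprM (_ : 25 * 41 = 1024 + 1)%N// exprD expr1 -{2}e5 bS -[(_ ^+ 4)^-1]expr1.
  rewrite E bS E bS E bS E bS E invrK.
  by rewrite !invrK mulfV// expf_neq0.
have z41P := @xi_primitive R 41 isT isT; have z5P := @xi_primitive R 5 isT isT.
have [l lE] : exists l, b 0 ^+ 25 = xi R 41 ^+ l.
  by have [l ->] := prim_rootP z41P b1025; exists l.
have bl i : b i ^+ 25 = diag41 R i ^+ l.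
  have z41 : xi R 41 ^+ 41 = 1 by exact: prim_expr_order.
  elim/ord5_cycle_ind: i => [|i IH]; first by rewrite lE diag41E.
  have y41 : (b i ^+ 25) ^+ 41 = 1.
    by rewrite IH diag41E -!exprM mulnC exprM z41 expr1n.
  have y0 : (b i ^+ 25) ^+ 4 != 0 by rewrite !expf_neq0.
  have -> : diag41 R (i + 1) ^+ l = (b i ^+ 25) ^+ 37.
    rewrite IH !diag41E -(klein_wt_succ _ z41).
    by rewrite [LHS]exprAC.
  by rewrite bS exprVn [b i ^+ 4 ^+ 25]exprAC; apply: (mulfI y0); rewrite mulfV// -exprD y41.
have w5 : (b 0 ^+ 41 ^+ 5) ^+ 5 = 1 by rewrite -!exprM -[RHS]b1025 -exprM.
have [m mE] : exists m, b 0 ^+ 41 ^+ 5 = xi R 5 ^+ m.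
  by have [m ->] := prim_rootP z5P w5; exists m.
(* These are fifth roots of unity, on which raising to the power -4 is the identity. *)
have bw i : b i ^+ 41 ^+ 5 = b 0 ^+ 41 ^+ 5.
  elim/ord5_cycle_ind: i => [//|i IH].
  have y0 : (b i ^+ 41 ^+ 5) ^+ 4 != 0 by rewrite !expf_neq0.
  rewrite bS !exprVn (_ : b i ^+ 4 ^+ 41 ^+ 5 = b i ^+ 41 ^+ 5 ^+ 4); last first.
    by rewrite [b i ^+ 4 ^+ 41]exprAC [LHS]exprAC.
  by apply: (mulfI y0); rewrite mulfV// -IH -exprSr IH w5.
(* Each step multiplies b_i^41 by b_i^(-205), which is xi_5^(-m); the exponent 4m replaces -m modulo
   5. *)
have bm i : b i ^+ 41 = b 0 ^+ 41 * diag5 R i ^+ (4 * m).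
  elim/ord5_cycle_ind: i => [|i IH]; first by rewrite /diag5 expr0 expr1n mulr1.
  have y0 : (b i ^+ 41) ^+ 4 != 0 by rewrite !expf_neq0.
  have x4 : xi R 5 ^+ (4 * m) = (b 0 ^+ 41 ^+ 5) ^+ 4 by rewrite mE -exprM mulnC.
  rewrite diag5_succ [X in _ * X]exprMn x4 mulrA -IH.
  rewrite bS exprVn [b i ^+ 4 ^+ 41]exprAC; apply: (mulfI y0); rewrite mulfV//.
  by rewrite mulrA -exprSr bw -exprS w5.
(* T^25 and T^41 lie in the two cyclic groups, T^1025 = 1, and
   25 * 23 + 41 * 11 = 1026. *)
have T25 : (pdiag a0 ^+ 25 = pdiag41 ^+ l)%g.
  apply: (pdiag_exp_eq _ _ (s := (nu ^+ 25)^-1)) => [|i].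
    by rewrite invr_eq0 expf_neq0.
  by rewrite -bl /b exprMn mulKf// expf_neq0.
have T41 : (pdiag a0 ^+ 41 = pdiag5 ^+ (4 * m))%g.
  apply: (pdiag_exp_eq _ _ (s := (nu ^+ 41)^-1 * b 0 ^+ 41)) => [|i].
    by rewrite mulf_neq0 ?invr_eq0 ?expf_neq0.
  by rewrite -mulrA -bm /b exprMn mulKf// expf_neq0.
exists (l * 23)%N, (4 * m * 11)%N; set T := pdiag a0.
rewrite 2!expgM -T25 -T41 -!expgM -expgD (_ : 25 * 23 + 41 * 11 = 1 + 25 * 41)%N//.
by rewrite expgD expg1 expgM T25 -expgM mulnC expgM pdiag41_exp expg1n mulg1.
Qed.
End KleinDiagonal.

(** * Symmetries of the Klein-type form inside G15 *)

Section KleinAutomorphisms.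
Local Open Scope quotient_scope.
Variable R : realType.
Local Notation C := R[i].

Definition pklein (j l m : nat) : PGL C 5 :=
  (pcycle R ^+ j * (pdiag41 R ^+ l * pdiag5 R ^+ m))%g.

Lemma klein_aut_form lam (A : GL C 5) c : c != 0 ->
  (forall x, klein lam (GLmx A *m x) = c * klein lam x) ->
  exists j l m, \pi_(PGL C 5) A = pklein j l m.
Proof.
move=> c0 Ac; have [s [a sa]] := klein_monomial (Defs.GL_unit A) c0 Ac.
have a0 i : a i != 0.
  have [_ ac] := sa i; apply: contraTneq isT => e.
  by move: ac; rewrite e expr0n mul0r => /esym/eqP; rewrite (negPf c0).
have [l [m lm]] := klein_diag a0 c0 (fun i => proj2 (sa i)).
(* The exponent is -s because [cycle_mx] sends e_i to e_{i-1}. *)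
exists (val (- s)), l, m; rewrite /pklein -lm.
have [B -> BE] := PGL_exp (MkGL (cycle_unit R)) (val (- s)).
rewrite [RHS]PGL_mulE; congr (\pi_ _ _); apply: val_inj => /=; rewrite BE /=.
suff e i : GLmx A *m delta_mx i 0 =
    cycle_mx R ^+ val (- s) *m diag_mx (\row_j a j) *m (delta_mx i 0 : 'cV_5).
  by apply/matrixP => r i; have /matrixP/(_ r 0) := e i; rewrite -!colE !mxE.
have [-> _] := sa i; rewrite -mulmxA.
have -> : (diag_mx (\row_j a j) : 'M_5) *m (delta_mx i 0 : 'cV_5) = a i *: delta_mx i 0.
  apply/colP => r; rewrite mul_diag_mx !mxE andbT.
  by case: eqP => [->|]; rewrite ?mulr0.
rewrite -scalemxAr cycle_exp_delta; congr (_ *: delta_mx _ _).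
by rewrite natr_Zp opprK.
Qed.

Lemma pklein_G15 j l m : G15 R (pklein j l m).
Proof.
move=> K [Ksub SK]; have K1 : K 1%g by case: Ksub => /set_mem.
have KM x y : K x -> K y -> K (x * y)%g.
  by move=> Kx Ky; apply: set_mem; apply: (group_closedM Ksub); exact: mem_set.
have KX x h : K x -> K (x ^+ h)%g.
  by move=> Kx; elim: h => [|h IH]; rewrite ?expg0// expgS; exact: KM.
apply: (KM); first by apply: KX; apply: SK; left; left.
by apply: (KM); apply: KX; apply: SK; [right|left; right].
Qed.

Lemma finite_pklein : finite_set [set g | exists j l m, g = pklein j l m].
Proof.
have E (x : PGL C 5) h j : (x ^+ h = 1)%g -> (x ^+ j = x ^+ (j %% h))%g.
  by move=> xh; rewrite {1}(divn_eq j h) mulnC expgD expgM xh expg1n mul1g.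
apply: (@sub_finite_set _ _ ((fun u => pklein u.1 u.2.1 u.2.2) @`
    (`I_5 `*` (`I_41 `*` `I_5)))).
  move=> _ [j [l [m ->]]]; exists (j %% 5, (l %% 41, m %% 5))%N => /=.
    by split; [|split]; rewrite /= ltn_mod.
  rewrite /pklein -(E _ 5%N); last exact: pcycle_exp5.
  rewrite -(E _ 41%N); last exact: pdiag41_exp.
  by rewrite -(E _ 5%N)//; exact: pdiag5_exp.
by apply/finite_image/finite_setX => //; exact: finite_setX.
Qed.
End KleinAutomorphisms.

Theorem theorem5p14 (R : realType) (X : set (projspace R[i] 4)) :
  smooth_hypersurface 5 X ->
  (exists2 g : PGL R[i] 5, projAut X g & has_order g 41) ->
  (exists H : set (PGL R[i] 5),
      [/\ is_subgroup H, H `<=` G15 R & isomorphic_subgroups (projAut X) H]) /\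
  (exists2 n : nat, (projAut X #= `I_n)%card & (5 %| n)%N).
Proof.
move=> [p [_ hp -> p_smooth]] [g0]; elim/quotW: g0 => A gA A41.
have d1 : (1 < 5)%N by [].
have smooth := singular_locus0P d1 hp p_smooth.
have AutP := projAutP d1 hp p_smooth.
have [c c0 Ac] := (AutP A).1 gA.
have [B [B41 B1 FB]] := lift_order41 hp (smooth_nonzero smooth) A41 c0 Ac.
have [P uP [lam PK]] := klein_normal_form hp smooth B41 B1 FB.
pose GP := MkGL uP; pose P' := (\pi_(PGL R[i] 5) GP)%qT : PGL R[i] 5.
set Aut := projAut _.
(* The coordinate change [P] turns automorphisms of X into symmetries of the Klein-type form. *)
have AutForm g : Aut g -> exists j l m, (g ^ P')%g = pklein R j l m.
  elim/quotW: g => D /(AutP D).1 [e e0 De].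
  have -> : (((\pi_(PGL R[i] 5) D)%qT : PGL R[i] 5) ^ P')%g =
      (\pi_(PGL R[i] 5) (GL_mul (GL_inv GP) (GL_mul D GP)))%qT.
    rewrite /P' conjgE [(_^-1)%g]PGL_invE [X in (_ * X)%g]PGL_mulE.
    exact: PGL_mulE.
  apply: (@klein_aut_form _ lam _ e e0) => x /=.
  by rewrite -!PK -!mulmxA mulKVmx// De.
(* Conversely, the cyclic shift is carried back to an automorphism of X of order 5. *)
have tAut : Aut (pcycle R ^ (P'^-1))%g.
  have -> : (pcycle R ^ (P'^-1))%g = (\pi_(PGL R[i] 5)
      (GL_mul GP (GL_mul (MkGL (cycle_unit R)) (GL_inv GP))))%qT.
    rewrite /P' conjgE invgK [(_^-1)%g]PGL_invE [X in (_ * X)%g]PGL_mulE.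
    exact: PGL_mulE.
  apply/AutP; exists 1; rewrite ?oner_eq0// => x /=.
  by rewrite -!mulmxA PK klein_cycle -PK mulKVmx// mul1r.
have Asub := projAut_subgroup (zero_locus p).
have AutM x y : Aut x -> Aut y -> Aut (x * y)%g.
  by move=> Kx Ky; apply: set_mem; apply: (group_closedM Asub); exact: mem_set.
split.
  exists ((fun g => g ^ P')%g @` Aut); split.
  - split=> [|_ _ /set_mem[x Ax <-] /set_mem[y Ay <-]]; apply: mem_set.
      by exists 1%g; [case: Asub => /set_mem|rewrite conj1g].
    exists (x / y)%g; last by rewrite conjMg conjVg.
    by case: Asub => _ D; apply: set_mem; apply: D; exact: mem_set.
  - by move=> _ [g /AutForm[j [l [m ->]]] <-]; exact: pklein_G15.
  - exists (fun g => g ^ P')%g; last by move=> x y _ _; rewrite conjMg.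
    split=> [x Ax|x y _ _|_ [x Ax <-]]; [by exists x|exact: conjg_inj|by exists x].
apply: (@finite_free_translation _ _ (pcycle R ^ (P'^-1))%g) => //.
- apply: (@sub_finite_set _ _ ((fun g => g ^ P'^-1)%g @`
    [set g | exists j l m, g = pklein R j l m])).
    by move=> g /AutForm gk; exists (g ^ P')%g; rewrite ?conjgK.
  exact/finite_image/finite_pklein.
- by rewrite -conjXg pcycle_exp5 conj1g.
- by move=> /eqP; rewrite conjg_eq1 => /eqP; exact: pcycle_neq1.
- by move=> x; exact: AutM.
Qed.
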